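(* Let $B$ be a bialgebra over a field $k$ and let $\mathcal{E}$ be the collection of all right $B$-module coalgebras $C$ such that the functor $\overline{?}:\mathcal{M}_B^C\to\mathcal{M}^{\overline{C}}$, $M\mapsto\overline{M}=M/MB^+$, is an equivalence. Then $\mathcal{E}$ is an idempotent radical class of $\mathbf{Coalg}\text{-}B$.
   Context: All algebras and coalgebras are over a field $k$ and $\otimes=\otimes_k$. A (right) $B$-module coalgebra is a coalgebra $C$ which is a right $B$-module such that $\Delta:C\to C\otimes C$ and $\varepsilon:C\to k$ are $B$-module maps ($C\otimes C$ with the diagonal $B$-action, $k$ the trivial module). $\mathbf{Coalg}\text{-}B$ is the category of right $B$-module coalgebras. A $B$-submodule coalgebra of $C$ is a subcoalgebra invariant under the $B$-action. For subspaces $X,Y\subseteq C$, $X\wedge Y=\Delta^{-1}(X\otimes C+C\otimes Y)$. For a collection $\mathcal{R}$ of $B$-module coalgebras, a member of $\mathcal{R}$ is called an $\mathcal{R}$-coalgebra, and a $B$-submodule coalgebra of $C$ which is a member of $\mathcal{R}$ is called an $\mathcal{R}$-subcoalgebra of $C$. A non-empty collection $\mathcal{R}$ of objects of $\mathbf{Coalg}\text{-}B$ is a radical class if: (R1) every $B$-submodule coalgebra of an $\mathcal{R}$-coalgebra is an $\mathcal{R}$-coalgebra; (R2) for any $C\in\mathbf{Coalg}\text{-}B$ and any family $\{C_i\}_{i\in I}$ of $\mathcal{R}$-subcoalgebras of $C$, $\sum_{i\in I}C_i\in\mathcal{R}$. It is idempotent if moreover: (R3) for any $C\in\mathbf{Coalg}\text{-}B$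 and any $\mathcal{R}$-subcoalgebras $C_1,C_2$ of $C$, $C_1\wedge C_2\in\mathcal{R}$. For a $B$-module coalgebra $C$, $\mathcal{M}_B^C$ is the category of right $(C,B)$-Hopf modules: right $B$-modules $M$ that are right $C$-comodules with structure map $\rho_M:M\to M\otimes C$ a $B$-module map ($M\otimes C$ with the diagonal $B$-action); morphisms are maps that are both $B$-module and $C$-comodule maps. $B^+=\ker\varepsilon_B$. $\overline{C}=C/CB^+$ is the quotient coalgebra of $C$, and $\mathcal{M}^{\overline{C}}$ is the category of right $\overline{C}$-comodules. For $M\in\mathcal{M}_B^C$, $\overline{M}=M/MB^+$ carries the induced right $\overline{C}$-comodule structure, $\overline{m}\mapsto\sum\overline{m_0}\otimes\overline{m_1}$ where $\rho_M(m)=\sum m_0\otimes m_1$. *)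

(* Defs.v *)
From HB Require Import structures.
From mathcomp Require Import all_boot all_algebra generic_quotient.
From mathcomp Require Import boolp classical_sets.
From mathcomp Require Import finmap.
From mathcomp Require Import monalg.

Set Implicit Arguments.
Unset Strict Implicit.
Unset Printing Implicit Defensive.

Import GRing.Theory.
Local Open Scope ring_scope.
Local Open Scope classical_set_scope.
Local Open Scope quotient_scope.

(* Vector spaces over k are arbitrary (possibly infinite-dimensional)
   lmodTypes.  Constants with a quotient or a choice of representative in their
   body are locked, so that conversion never unfolds them; they are meant to be
   used through the lemmas that follow them. *)

Section Subspaces.
Variables (k : fieldType) (V : lmodType k).

Definition subspace (D : set V) : Prop :=
  D 0 /\ forall (a : k) (u v : V), D u -> D v -> D (a *: u + v).

Definition lspan (S : set V) : set V := smallest subspace S.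

Lemma lspan_subspace S : subspace (lspan S).
Proof.
split=> [D [[D0 _] _]|a u v Su Sv D HD] //.
by have [[_ DZ] _] := HD; apply: DZ; [apply: Su|apply: Sv].
Qed.

End Subspaces.

Section QuotientType.
Variables (k : fieldType) (V : lmodType k) (S : set V).

Definition in_lspan : {pred V} := [pred v | `[< lspan S v >]].

Lemma in_lspanE v : (v \in in_lspan) <-> lspan S v.
Proof. by rewrite unfold_in /=; split=> [/asboolP|h] //; apply/asboolP. Qed.

Lemma in_lspan_closed : GRing.submod_closed in_lspan.
Proof.
have [S0 SZ] := lspan_subspace S.
split=> [|a u v /in_lspanE Su /in_lspanE Sv]; apply/in_lspanE.
  exact: S0.
exact: SZ.
Qed.

HB.instance Definition _ :=
  GRing.isSubmodClosed.Build k V in_lspan in_lspan_closed.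

Definition quot_type : Type := Quotient.quot in_lspan.
HB.instance Definition _ := GRing.Zmodule.on quot_type.
End QuotientType.

HB.lock Definition quot_pi (k : fieldType) (V : lmodType k) (S : set V)
  (v : V) : quot_type S := \pi_(Quotient.quot (in_lspan S)) v.
HB.lock Definition quot_repr (k : fieldType) (V : lmodType k) (S : set V)
  (x : quot_type S) : V := repr (x : Quotient.quot (in_lspan S)).
HB.lock Definition quot_scale (k : fieldType) (V : lmodType k) (S : set V)
  (a : k) (x : quot_type S) : quot_type S := quot_pi S (a *: quot_repr x).

Section Quotient.
Variables (k : fieldType) (V : lmodType k) (S : set V).
Local Notation quot_type := (quot_type S).
Local Notation quot_pi := (@quot_pi k V S).
Local Notation quot_repr := (@quot_repr k V S).
Local Notation quot_scale := (@quot_scale k V S).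
Local Notation in_lspan := (in_lspan S).

Lemma quot_reprK x : quot_pi (quot_repr x) = x.
Proof. by rewrite quot_pi.unlock quot_repr.unlock; exact: reprK. Qed.

Lemma quot_piB u v : quot_pi u = quot_pi v <-> lspan S (u - v).
Proof.
rewrite quot_pi.unlock; apply: iff_trans (in_lspanE _ _).
by rewrite (Quotient.idealrBE in_lspan u v); split=> [e|/eqP]; first exact/eqP.
Qed.

Lemma quot_piD u v : quot_pi (u + v) = quot_pi u + quot_pi v.
Proof. by rewrite quot_pi.unlock; exact: (Quotient.pi_add in_lspan u v). Qed.

Lemma quot_piZ a v : quot_pi (a *: v) = quot_scale a (quot_pi v).
Proof.
rewrite quot_scale.unlock; apply/quot_piB; rewrite -scalerBr -[a *: _]addr0.
have [S0 SZ] := lspan_subspace S.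
by apply: SZ => //; apply/quot_piB; rewrite quot_reprK.
Qed.

Lemma quot_scaleA a b x : quot_scale a (quot_scale b x) = quot_scale (a * b) x.
Proof. by rewrite -[x]quot_reprK -!quot_piZ scalerA. Qed.
Lemma quot_scale1 : left_id 1 quot_scale.
Proof. by move=> x; rewrite -[x]quot_reprK -quot_piZ scale1r. Qed.
Lemma quot_scaleDr : right_distributive quot_scale +%R.
Proof.
move=> a x y; rewrite -[x]quot_reprK -[y]quot_reprK.
by rewrite -quot_piD -!quot_piZ -quot_piD scalerDr.
Qed.
Lemma quot_scaleDl x : {morph quot_scale^~ x : a b / a + b}.
Proof.
by move=> a b; rewrite -[x]quot_reprK -!quot_piZ -quot_piD scalerDl.
Qed.
HB.instance Definition _ := GRing.Zmodule_isLmodule.Build k quot_type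
  quot_scaleA quot_scale1 quot_scaleDr quot_scaleDl.

Definition quot : lmodType k := quot_type.

Lemma quot_pi_linear : linear (quot_pi : V -> quot).
Proof. by move=> a u v; rewrite quot_piD quot_piZ. Qed.
HB.instance Definition _ :=
  GRing.isLinear.Build k V quot *:%R (quot_pi : V -> quot) quot_pi_linear.

Definition qproj : {linear V -> quot} := (quot_pi : V -> quot).

Lemma qproj_surj (x : quot) : exists v, qproj v = x.
Proof. by exists (quot_repr x); exact: quot_reprK. Qed.

Lemma qproj_eq u v : qproj u = qproj v <-> lspan S (u - v).
Proof. exact: quot_piB. Qed.

Lemma qproj_eq0 v : S v -> qproj v = 0.
Proof.
move=> Sv; rewrite -(linear0 qproj); apply/qproj_eq; rewrite subr0.
exact: sub_gen_smallest.
Qed.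

End Quotient.

(* The map induced on the quotient by f.  It is total in f, and is the expected
   factorisation (qliftE, qlift_linear) when f is linear and kills S. *)
HB.lock Definition qlift (k : fieldType) (V : lmodType k) (S : set V)
  (W : lmodType k) (f : V -> W) (x : quot S) : W := f (quot_repr x).

Section QliftTheory.
Variables (k : fieldType) (V : lmodType k) (S : set V).
Variables (W : lmodType k) (f : {linear V -> W}).
Hypothesis f0 : forall v, S v -> f v = 0.

Lemma qliftE v : qlift f (qproj S v) = f v.
Proof.
rewrite qlift.unlock; apply/eqP; rewrite -subr_eq0 -linearB; apply/eqP.
have : lspan S (quot_repr (qproj S v) - v) by apply/quot_piB; rewrite quot_reprK.
apply: (smallest_sub (X := [set v | f v = 0])) => //; split=> [|a x y] /=.
  exact: linear0.
by move=> fx fy; rewrite linearP fx fy scaler0 addr0.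
Qed.

Lemma qlift_linear : linear (qlift f : quot S -> W).
Proof.
move=> a x y; have [u <-] := qproj_surj x; have [v <-] := qproj_surj y.
by rewrite -linearP !qliftE linearP.
Qed.

End QliftTheory.

Notation bilinear f := (bilinear_for *:%R *:%R f).

Section LinearMaps.
Variables (k : fieldType) (U V : lmodType k).

Lemma linear_ext (f g : {linear U -> V}) : f =1 g -> f = g.
Proof.
move=> /funext; case: f g => [f Hf] [g Hg] /= e; subst g.
case: Hf => [[a] [b]]; case: Hg => [[a'] [b']].
by rewrite (Prop_irrelevance a a') (Prop_irrelevance b b').
Qed.

Definition mklin (f : U -> V) (Hf : linear f) : {linear U -> V} :=
  HB.pack f (GRing.isLinear.Build k U V *:%R f Hf).

End LinearMaps.

(* U ⊗ V is the free vector space on U * V modulo the bilinearity relations. *)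
Definition tensor_rel (k : fieldType) (U V : lmodType k) :
    set {malg k[(U * V)%type]} :=
  [set r | (exists a u1 u2 v,
       r = << (a *: u1 + u2, v) >> - (a *: << (u1, v) >> + << (u2, v) >>))
    \/ (exists a u v1 v2,
       r = << (u, a *: v1 + v2) >> - (a *: << (u, v1) >> + << (u, v2) >>))].

Definition tensor (k : fieldType) (U V : lmodType k) : lmodType k :=
  quot (@tensor_rel k U V).

HB.lock Definition tens (k : fieldType) (U V : lmodType k) (u : U) (v : V) :
  tensor U V := qproj (@tensor_rel k U V) << (u, v) >>.

HB.lock Definition free_lift (k : fieldType) (U V W : lmodType k)
    (f : U * V -> W) (g : {malg k[(U * V)%type]}) : W :=
  \sum_(p <- msupp g) g@_p *: f p.

(* The map U ⊗ V -> W induced by f.  It is total in f, and is the linear map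
   given by the universal property (tliftE, tlift_linear) when f is bilinear,
   which is the case wherever it is used below. *)
HB.lock Definition tlift (k : fieldType) (U V W : lmodType k)
    (f : U -> V -> W) : tensor U V -> W :=
  qlift (free_lift (fun p => f p.1 p.2)).

Section Tensor.
Variables (k : fieldType) (U V : lmodType k).

Local Notation free := {malg k[(U * V)%type]}.
Local Notation gen u v := (<< (u, v) >> : free).
Local Notation tensor := (tensor U V).
Local Notation tens := (@tens k U V).
Local Notation tensor_rel := (@tensor_rel k U V).

Lemma tens_bilinear : bilinear tens.
Proof.
rewrite tens.unlock.
split=> [v a u1 u2|u a v1 v2]; rewrite -linearP; apply/qproj_eq;
  apply: sub_gen_smallest; [left|right].
  by exists a, u1, u2, v.
by exists a, u, v1, v2.
Qed.

Section FreeLift.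
Variables (W : lmodType k) (f : U * V -> W).

Local Notation free_lift := (@free_lift k U V W f).

Lemma free_liftEw (g : free) (d : {fset U * V}) : (msupp g `<=` d)%fset ->
  free_lift g = \sum_(p <- d) g@_p *: f p.
Proof.
move=> sgd; rewrite free_lift.unlock; apply: big_fset_incl => // p _ pg.
by rewrite mcoeff_outdom // scale0r.
Qed.

Lemma free_lift_linear : linear free_lift.
Proof.
move=> a g h; pose d := (msupp g `|` msupp h `|` msupp (a *: g + h))%fset.
rewrite !(@free_liftEw _ d).
- rewrite scaler_sumr -big_split /=; apply: eq_bigr => p _.
  by rewrite mcoeffD mcoeffZ scalerDl scalerA.
- by rewrite /d; apply/fsubsetP => x xh; rewrite !inE xh orbT.
- by rewrite /d; apply/fsubsetP => x xh; rewrite !inE xh.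
- by rewrite /d; apply/fsubsetP => x xh; rewrite !inE xh !orbT.
Qed.
HB.instance Definition _ :=
  GRing.isLinear.Build k free W *:%R free_lift free_lift_linear.

Lemma free_liftE p : free_lift << p >> = f p.
Proof.
rewrite (@free_liftEw _ [fset p]%fset) ?msuppU_le //.
by rewrite big_seq_fset1 mcoeffUU scale1r.
Qed.
End FreeLift.

Lemma tensor_ind (P : tensor -> Prop) :
  P 0 -> (forall a u v t, P t -> P (a *: tens u v + t)) -> forall t, P t.
Proof.
move=> P0 PS t; have [g <-] := qproj_surj t.
rewrite [g]monalgE linear_sum /=; elim/big_rec: _ => [//|[u v] t' _ Pt'].
rewrite (_ : << g@_(u, v) *g (u, v) >> = g@_(u, v) *: gen u v) ?linearZ.
  by have := PS g@_(u, v) u v _ Pt'; rewrite tens.unlock.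
by apply/malgP => x; rewrite mcoeffZ !mcoeffU mulrnAr mulr1.
Qed.

Section TliftTheory.
Variables (W : lmodType k) (f : U -> V -> W).
Hypothesis f_bilin : bilinear f.

Lemma free_lift_rel r : tensor_rel r -> free_lift (fun p => f p.1 p.2) r = 0.
Proof.
have [fl fr] := f_bilin.
by case=> [[a [u1 [u2 [v ->]]]]|[a [u [v1 [v2 ->]]]]];
  rewrite linearB linearP /= !free_liftE /= ?(fl v) ?(fr u) subrr.
Qed.

Lemma tliftE u v : tlift f (tens u v) = f u v.
Proof.
rewrite tlift.unlock tens.unlock qliftE /=; first by rewrite free_liftE.
exact: free_lift_rel.
Qed.

Lemma tlift_linear : linear (tlift f).
Proof. by rewrite tlift.unlock; apply: qlift_linear; exact: free_lift_rel. Qed.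

End TliftTheory.
End Tensor.

Notation "U ⊗ V" := (tensor U V) (at level 40, left associativity).

Section TensorMaps.
Variable k : fieldType.
Implicit Types U V W : lmodType k.

Lemma tlift_ext U V W (f g : {linear U ⊗ V -> W}) :
  (forall u v, f (tens u v) = g (tens u v)) -> f =1 g.
Proof.
move=> fg; elim/tensor_ind => [|a u v t IH]; first by rewrite !linear0.
by rewrite !linearP IH fg.
Qed.

Definition tmap U V U' V' (f : U -> U') (g : V -> V') : U ⊗ V -> U' ⊗ V' :=
  tlift (fun u v => tens (f u) (g v)).

Section TmapTheory.
Variables (U V U' V' : lmodType k) (f : {linear U -> U'}) (g : {linear V -> V'}).

Lemma tmap_bilinear : bilinear (fun u v => tens (f u) (g v)).
Proof.
have [tl tr] := tens_bilinear U' V'.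
by split=> [v|u] a x y; rewrite linearP; [exact: tl|exact: tr].
Qed.

Lemma tmapE u v : tmap f g (tens u v) = tens (f u) (g v).
Proof. exact: (tliftE tmap_bilinear). Qed.

Lemma tmap_linear : linear (tmap f g).
Proof. exact: (tlift_linear tmap_bilinear). Qed.

HB.instance Definition _ :=
  GRing.isLinear.Build k (U ⊗ V) (U' ⊗ V') *:%R (tmap f g) tmap_linear.
End TmapTheory.

Definition tassoc U V W : (U ⊗ V) ⊗ W -> U ⊗ (V ⊗ W) :=
  tlift (fun t w => tlift (fun u v => tens u (tens v w)) t).

(* (u ⊗ u') (v ⊗ v') |-> f u v ⊗ g u' v': with f, g two actions this is the
   componentwise action, with f, g two products the product of the tensor
   algebra. *)
Definition tact U V W U' V' W' (f : U -> V -> W) (g : U' -> V' -> W') :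
    U ⊗ U' -> V ⊗ V' -> W ⊗ W' :=
  fun t s =>
    tlift (fun u u' => tlift (fun v v' => tens (f u v) (g u' v')) s) t.

Lemma tlift_addf U V W (f g h : U -> V -> W) a :
  bilinear f -> bilinear g -> bilinear h ->
  (forall u v, f u v = a *: g u v + h u v) ->
  forall t, tlift f t = a *: tlift g t + tlift h t.
Proof.
move=> fb gb hb e; elim/tensor_ind => [|b u v t IH].
  have z F (Fb : bilinear F) : tlift F 0 = 0 :> W.
    exact: (linear0 (mklin (tlift_linear Fb))).
  by rewrite !z // scaler0 addr0.
rewrite (tlift_linear fb) (tlift_linear gb) (tlift_linear hb) IH.
rewrite (tliftE fb) (tliftE gb) (tliftE hb) e !scalerDr !scalerA [a * b]mulrC.
by rewrite addrACA.
Qed.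

Lemma tens_linl U V (v : V) a (x y : U) :
  tens (a *: x + y) v = a *: tens x v + tens y v.
Proof. by have [tl _] := tens_bilinear U V; exact: tl. Qed.
Lemma tens_linr U V (u : U) a (x y : V) :
  tens u (a *: x + y) = a *: tens u x + tens u y.
Proof. by have [_ tr] := tens_bilinear U V; exact: tr. Qed.

Lemma tassoc_bilinear_in U V W (w : W) :
  bilinear (fun (u : U) (v : V) => tens u (tens v w)).
Proof.
split=> [v|u] a x y; first exact: tens_linl.
by rewrite tens_linl tens_linr.
Qed.

Lemma tassoc_bilinear U V W :
  bilinear (fun t (w : W) => tlift (fun (u : U) (v : V) => tens u (tens v w)) t).
Proof.
split=> [w|t] a x y; first by rewrite (tlift_linear (tassoc_bilinear_in U V w)).
apply: tlift_addf; try exact: tassoc_bilinear_in.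
by move=> u v; rewrite !tens_linr.
Qed.

Lemma tassocE U V W (u : U) (v : V) (w : W) :
  tassoc (tens (tens u v) w) = tens u (tens v w).
Proof.
rewrite /tassoc (tliftE (@tassoc_bilinear U V W)).
by rewrite (tliftE (tassoc_bilinear_in U V w)).
Qed.

Lemma tassoc_linear U V W : linear (@tassoc U V W).
Proof. exact: (tlift_linear (@tassoc_bilinear U V W)). Qed.

HB.instance Definition _ U V W :=
  GRing.isLinear.Build k ((U ⊗ V) ⊗ W) (U ⊗ (V ⊗ W)) *:%R
    (@tassoc U V W) (@tassoc_linear U V W).

Section TactTheory.
Variables (U V W U' V' W' : lmodType k) (f : U -> V -> W) (g : U' -> V' -> W').
Hypotheses (fb : bilinear f) (gb : bilinear g).

Lemma tact_bilinear_in u u' : bilinear (fun v v' => tens (f u v) (g u' v')).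
Proof.
have [fl fr] := fb; have [gl gr] := gb.
split=> [v'|v] a x y; first by rewrite fr tens_linl.
by rewrite gr tens_linr.
Qed.

Lemma tact_bilinear_out s : bilinear (fun u u' =>
  tlift (fun v v' => tens (f u v) (g u' v')) s).
Proof.
have [fl fr] := fb; have [gl gr] := gb.
split=> [u'|u] a x y; apply: tlift_addf; try exact: tact_bilinear_in.
  by move=> v v'; rewrite fl tens_linl.
by move=> v v'; rewrite gl tens_linr.
Qed.

Lemma tactE u u' v v' :
  tact f g (tens u u') (tens v v') = tens (f u v) (g u' v').
Proof.
rewrite /tact (tliftE (tact_bilinear_out _)).
by rewrite (tliftE (tact_bilinear_in _ _)).
Qed.

Lemma tact_bilinear : bilinear (tact f g).
Proof.
split=> [s|t] a x y; first exact: (tlift_linear (tact_bilinear_out s) a x y).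
apply: tlift_addf; try exact: tact_bilinear_out.
by move=> u u'; rewrite (tlift_linear (tact_bilinear_in u u')).
Qed.
End TactTheory.

End TensorMaps.

Section TensorFunctoriality.
Variable k : fieldType.
Implicit Types U V W : lmodType k.

Lemma tmap_comp U V U' V' U2 V2 (f' : {linear U -> U'}) (g' : {linear V -> V'})
    (f : {linear U' -> U2}) (g : {linear V' -> V2}) t :
  tmap f g (tmap f' g' t) = tmap (f \o f') (g \o g') t.
Proof.
move: t; apply: (tlift_ext (f := tmap f g \o tmap f' g')) => u v.
by rewrite /= !tmapE.
Qed.

Lemma tmap_id U V (t : U ⊗ V) : tmap idfun idfun t = t.
Proof.
move: t; apply: (tlift_ext (f := tmap idfun idfun) (g := idfun)) => u v /=.
by rewrite tmapE.
Qed.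

Lemma tens0l U V (v : V) : tens (0 : U) v = 0.
Proof. exact: (linear0 (mklin (@tens_linl k U V v))). Qed.

Lemma tlift_ext3 U V W (X : lmodType k) (F G : {linear (U ⊗ V) ⊗ W -> X}) :
  (forall u v w, F (tens (tens u v) w) = G (tens (tens u v) w)) -> F =1 G.
Proof.
move=> FG; apply: tlift_ext => t w; elim/tensor_ind: t => [|a u v t IH].
  by rewrite tens0l !linear0.
rewrite tens_linl.
rewrite (linearP F).
rewrite (linearP G).
rewrite IH.
by rewrite FG.
Qed.

Lemma tassoc_nat U V W U' V' W' (f : {linear U -> U'}) (g : {linear V -> V'})
    (h : {linear W -> W'}) t :
  tassoc (tmap (tmap f g) h t) = tmap f (tmap g h) (tassoc t).
Proof.
move: t; apply: (@tlift_ext3 _ _ _ _ (@tassoc k _ _ _ \o tmap (tmap f g) h)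
  (tmap f (tmap g h) \o @tassoc k _ _ _)) => u v w /=.
by rewrite tmapE /= tmapE !tassocE tmapE /= tmapE.
Qed.

(* Over a field subspaces have complements (Zorn), so tensor products of
   injective maps are injective; this makes D ⊗ D a subspace of C ⊗ C in the
   construction of subcoalgebras. *)
Lemma linear_retract U V (f : {linear U -> V}) : injective f ->
  exists r : {linear V -> U}, cancel f r.
Proof.
move=> f_inj.
pose P (W : set V) := (forall a u v, W u -> W v -> W (a *: u + v)) /\
  (forall u, W (f u) -> u = 0).
have [|A [[Alin Af] Amax]] := @Zorn_bigcup V P.
  move=> F FP Ftot; split=> [a u v [X FX Xu] [Y FY Yv]|u [X FX Xu]].
    have [XY|YX] := Ftot _ _ FX FY.
      by exists Y => //; apply: (FP _ FY).1 => //; exact: XY.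
    by exists X => //; apply: (FP _ FX).1 => //; exact: YX.
  exact: (FP _ FX).2 Xu.
have A0 : A 0.
  apply: contrapT => nA0; apply: (Amax [set 0]); last first.
    split=> [a u v -> ->|u /= fu0]; first by rewrite /= scaler0 addr0.
    by apply: f_inj; rewrite linear0.
  have Ae v : ~ A v.
    by move=> Av; apply: nA0; rewrite -(addNr v) -scaleN1r; exact: Alin.
  by split=> [v /Ae //|/(_ 0 erefl)].
have dec v : exists u, A (v - f u).
  apply: contrapT => nv.
  pose A' : set V := [set z | exists x c, A x /\ z = c *: v + x].
  apply: (Amax A').
    split=> [x Ax|A'A]; first by exists x, 0; rewrite scale0r add0r.
    apply: nv; exists 0; rewrite linear0 subr0; apply: A'A.
    by exists 0, 1; rewrite scale1r addr0.
  split=> [a _ _ [x [c [Ax ->]]] [y [d [Ay ->]]]|u [x [c [Ax fuE]]]].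
    exists (a *: x + y), (a * c + d); split; first exact: Alin.
    by rewrite scalerDr scalerDl scalerA addrACA.
  have [c0|c0] := eqVneq c 0; first by apply: Af; rewrite fuE c0 scale0r add0r.
  case: nv; exists (c^-1 *: u); rewrite linearZ /= fuE scalerDr scalerA mulVf //.
  rewrite scale1r opprD addrA subrr sub0r -scaleNr -[_ *: x]addr0.
  exact: Alin.
have dec_uniq v u u' : A (v - f u) -> A (v - f u') -> u = u'.
  move=> Au Au'; apply/eqP; rewrite -subr_eq0; apply/eqP/Af.
  rewrite linearB; have := Alin (-1) _ _ Au Au'.
  by rewrite scaleN1r opprB addrA subrK.
pose r v := projT1 (cid (dec v)).
have rP v : A (v - f (r v)) by exact: (projT2 (cid (dec v))).
have r_lin : linear r.
  move=> a x y; apply: (dec_uniq (a *: x + y)); first exact: rP.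
  have := Alin a _ _ (rP x) (rP y).
  by rewrite linearP scalerBr opprD addrACA.
exists (mklin r_lin) => u; apply: (dec_uniq (f u)); first exact: rP.
by rewrite subrr.
Qed.

Lemma tmap_inj U V U' V' (f : {linear U -> U'}) (g : {linear V -> V'}) :
  injective f -> injective g -> injective (tmap f g).
Proof.
move=> /linear_retract[r fr] /linear_retract[s gs].
apply: (can_inj (g := tmap r s)) => t; rewrite tmap_comp -[RHS]tmap_id.
by congr (tmap _ _ t); apply/funext => x /=; rewrite ?fr ?gs.
Qed.

End TensorFunctoriality.

Section Structures.
Variable k : fieldType.

Record coalg_on (V : lmodType k) := CoalgOn {
  cdelta : {linear V -> V ⊗ V};
  ceps : {scalar V};
  cdeltaA : forall c,
    tassoc (tmap cdelta idfun (cdelta c)) = tmap idfun cdelta (cdelta c);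
  cepsl : forall c, tlift (fun c1 c2 => ceps c1 *: c2) (cdelta c) = c;
  cepsr : forall c, tlift (fun c1 c2 => ceps c2 *: c1) (cdelta c) = c
}.

Record coalgebra := Coalgebra {
  coalg_car :> lmodType k;
  coalg_str :> coalg_on coalg_car
}.

Record bialgebra := Bialgebra {
  bialg_car :> algType k;
  bialg_str :> coalg_on bialg_car;
  bdelta1 : cdelta bialg_str 1 = tens 1 1;
  bdeltaM : forall x y, cdelta bialg_str (x * y) =
    tact *%R *%R (cdelta bialg_str x) (cdelta bialg_str y);
  beps1 : ceps bialg_str 1 = 1;
  bepsM : forall x y, ceps bialg_str (x * y) = ceps bialg_str x * ceps bialg_str y
}.

Section Modules.
Variable B : bialgebra.

Record rmod_on (V : lmodType k) := RModOn {
  act : V -> B -> V;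
  act_bilinear : bilinear act;
  act1 : forall v, act v 1 = v;
  actM : forall v x y, act v (x * y) = act (act v x) y
}.

Definition diag_act (V W : lmodType k) (a : rmod_on V) (a' : rmod_on W)
    (t : V ⊗ W) (b : B) : V ⊗ W :=
  tact (act a) (act a') t (cdelta B b).

Record modcoalg := ModCoalg {
  mc_car :> lmodType k;
  mc_coalg : coalg_on mc_car;
  mc_rmod : rmod_on mc_car;
  mc_delta_act : forall c b, cdelta mc_coalg (act mc_rmod c b) =
    diag_act mc_rmod mc_rmod (cdelta mc_coalg c) b;
  mc_eps_act : forall c b,
    ceps mc_coalg (act mc_rmod c b) = ceps mc_coalg c * ceps B b
}.

End Modules.

Record comod_on (D : coalgebra) (M : lmodType k) := ComodOn {
  corho : {linear M -> M ⊗ D};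
  corhoA : forall m,
    tassoc (tmap corho idfun (corho m)) = tmap idfun (cdelta D) (corho m);
  corho_eps : forall m, tlift (fun m0 d => ceps D d *: m0) (corho m) = m
}.

Record comodule (D : coalgebra) := Comodule {
  comod_car :> lmodType k;
  comod_str :> comod_on D comod_car
}.

Record comod_hom (D : coalgebra) (M N : comodule D) := ComodHom {
  comod_fun :> {linear M -> N};
  comod_funP : forall m, corho N (comod_fun m) = tmap comod_fun idfun (corho M m)
}.

Definition mc_coalgebra (B : bialgebra) (C : modcoalg B) : coalgebra :=
  Coalgebra (mc_coalg C).

Record hopf_module (B : bialgebra) (C : modcoalg B) := HopfModule {
  hm_car :> lmodType k;
  hm_rmod : rmod_on B hm_car;
  hm_comod : comod_on (mc_coalgebra C) hm_car;
  hm_rho_act : forall m b, corho hm_comod (act hm_rmod m b) =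
    diag_act hm_rmod (mc_rmod C) (corho hm_comod m) b
}.

Record hopf_hom (B : bialgebra) (C : modcoalg B) (M N : hopf_module C) :=
  HopfHom {
  hopf_fun :> {linear M -> N};
  hopf_fun_act : forall m b,
    hopf_fun (act (hm_rmod M) m b) = act (hm_rmod N) (hopf_fun m) b;
  hopf_fun_rho : forall m, corho (hm_comod N) (hopf_fun m) =
    tmap hopf_fun idfun (corho (hm_comod M) m)
}.

End Structures.

Section Transport.
Variable k : fieldType.

Lemma tlift_tmap (U V U' V' W : lmodType k) (F : U' -> V' -> W)
    (f : {linear U -> U'}) (g : {linear V -> V'}) t :
  bilinear F -> tlift F (tmap f g t) = tlift (fun u v => F (f u) (g v)) t.
Proof.
move=> Fb; have Fgb : bilinear (fun u v => F (f u) (g v)).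
  by have [Fl Fr] := Fb; split=> [v|u] a x y; rewrite linearP ?Fl ?Fr.
move: t; apply: (tlift_ext (f := mklin (tlift_linear Fb) \o tmap f g)
  (g := mklin (tlift_linear Fgb))) => u v /=.
by rewrite tmapE (tliftE Fb) (tliftE Fgb).
Qed.

Lemma linear_tlift (U V W X : lmodType k) (F : U -> V -> W)
    (h : {linear W -> X}) t :
  bilinear F -> h (tlift F t) = tlift (fun u v => h (F u v)) t.
Proof.
move=> Fb; have hFb : bilinear (fun u v => h (F u v)).
  by have [Fl Fr] := Fb; split=> [v|u] a x y; rewrite ?Fl ?Fr linearP.
move: t; apply: (tlift_ext (f := h \o mklin (tlift_linear Fb))
  (g := mklin (tlift_linear hFb))) => u v /=.
by rewrite (tliftE Fb) (tliftE hFb).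
Qed.

Lemma scalel_bilinear (U V : lmodType k) (e : {scalar U}) :
  bilinear (fun u (v : V) => e u *: v).
Proof.
split=> [v|u] a x y /=; first by rewrite linearP scalerDl scalerA.
by rewrite scalerDr !scalerA mulrC.
Qed.

Lemma scaler_bilinear (U V : lmodType k) (e : {scalar V}) :
  bilinear (fun (u : U) v => e v *: u).
Proof.
split=> [v|u] a x y /=; last by rewrite linearP scalerDl scalerA.
by rewrite scalerDr !scalerA mulrC.
Qed.

Lemma tensZl (U V : lmodType k) a (u : U) (v : V) :
  tens (a *: u) v = a *: tens u v.
Proof. by rewrite -[a *: u]addr0 tens_linl tens0l addr0. Qed.

Lemma tensZr (U V : lmodType k) a (u : U) (v : V) :
  tens u (a *: v) = a *: tens u v.
Proof.
have t0 : tens u (0 : V) = 0 := linear0 (mklin (@tens_linr k U V u)).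
by rewrite -[a *: v]addr0 tens_linr t0 addr0.
Qed.

Section Coassoc.
Variables (M M' D D' : lmodType k) (f : {linear M -> M'}) (g : {linear D -> D'}).
Variables (rho : {linear M -> M ⊗ D}) (rho' : {linear M' -> M' ⊗ D'}).
Variables (delta : {linear D -> D ⊗ D}) (delta' : {linear D' -> D' ⊗ D'}).
Variables (e : {scalar D}) (e' : {scalar D'}).
Hypothesis rho_f : forall m, rho' (f m) = tmap f g (rho m).
Hypothesis delta_g : forall d, delta' (g d) = tmap g g (delta d).
Hypothesis e_g : forall d, e' (g d) = e d.

Lemma coassocl_transport m : tassoc (tmap rho' idfun (rho' (f m))) =
  tmap f (tmap g g) (tassoc (tmap rho idfun (rho m))).
Proof.
rewrite rho_f -tassoc_nat !tmap_comp; congr (tassoc (tmap _ _ _)).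
by apply/funext => x /=; rewrite rho_f.
Qed.

Lemma coassocr_transport m : tmap idfun delta' (rho' (f m)) =
  tmap f (tmap g g) (tmap idfun delta (rho m)).
Proof.
rewrite rho_f !tmap_comp; congr (tmap _ _ _).
by apply/funext => x /=; rewrite delta_g.
Qed.

Lemma counitr_transport m : tlift (fun m0 d => e' d *: m0) (rho' (f m)) =
  f (tlift (fun m0 d => e d *: m0) (rho m)).
Proof.
rewrite rho_f (tlift_tmap _ _ _ (scaler_bilinear _ e')).
rewrite (linear_tlift _ _ (scaler_bilinear _ e)).
by congr (tlift _ _); apply/funext => x; apply/funext => y;
   rewrite linearZ e_g.
Qed.
End Coassoc.

Lemma counitl_transport (D D' : lmodType k) (g : {linear D -> D'})
    (delta : {linear D -> D ⊗ D}) (delta' : {linear D' -> D' ⊗ D'})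
    (e : {scalar D}) (e' : {scalar D'}) :
  (forall d, delta' (g d) = tmap g g (delta d)) ->
  (forall d, e' (g d) = e d) ->
  forall d, tlift (fun d0 d1 => e' d0 *: d1) (delta' (g d)) =
    g (tlift (fun d0 d1 => e d0 *: d1) (delta d)).
Proof.
move=> delta_g e_g d; rewrite delta_g (tlift_tmap _ _ _ (scalel_bilinear _ e')).
rewrite (linear_tlift _ _ (scalel_bilinear _ e)).
by congr (tlift _ _); apply/funext => x; apply/funext => y;
   rewrite linearZ e_g.
Qed.

End Transport.

Section Reduction.
Variables (k : fieldType) (B : bialgebra k).

(* V B^+ is the span of this set, and bar a = V / V B^+. *)
Definition augmented (V : lmodType k) (a : rmod_on B V) : set V :=
  [set x | exists v b, ceps B b = 0 /\ x = act a v b].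

Definition bar (V : lmodType k) (a : rmod_on B V) : lmodType k :=
  quot (augmented a).

Definition barpi (V : lmodType k) (a : rmod_on B V) : {linear V -> bar a} :=
  qproj (augmented a).

Definition bar_lift (V W : lmodType k) (a : rmod_on B V) (f : {linear V -> W})
    (f0 : forall v, augmented a v -> f v = 0) : {linear bar a -> W} :=
  mklin (qlift_linear f0).

Lemma bar_liftE (V W : lmodType k) (a : rmod_on B V) (f : {linear V -> W})
    (f0 : forall v, augmented a v -> f v = 0) v :
  bar_lift f0 (barpi a v) = f v.
Proof. exact: qliftE. Qed.

Lemma barpi_surj (V : lmodType k) (a : rmod_on B V) x :
  exists v, barpi a v = x.
Proof. exact: qproj_surj. Qed.

Lemma barpi_act (V : lmodType k) (a : rmod_on B V) v b :
  barpi a (act a v b) = ceps B b *: barpi a v.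
Proof.
have [al ar] := act_bilinear a.
have e : act a v b = ceps B b *: v + act a v (b - ceps B b *: 1).
  by rewrite -scaleNr [b + _]addrC ar act1 /= scaleNr addrA subrr add0r.
rewrite e linearP (_ : barpi a (act a v _) = 0) ?addr0 //.
apply: qproj_eq0; exists v, (b - ceps B b *: 1); split=> //.
by rewrite linearB linearZ /= beps1 mulr1 subrr.
Qed.

Lemma barpi_diag (V W : lmodType k) (a : rmod_on B V) (a' : rmod_on B W) t b :
  tmap (barpi a) (barpi a') (diag_act a a' t b) =
  ceps B b *: tmap (barpi a) (barpi a') t.
Proof.
have [ab a'b] := (act_bilinear a, act_bilinear a').
have [l _] := tact_bilinear ab a'b.
move: t; apply: (tlift_ext
  (f := tmap (barpi a) (barpi a') \o mklin (l (cdelta B b)))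
  (g := *:%R (ceps B b) \o tmap (barpi a) (barpi a'))) => u v /=.
set T := tens (barpi a u) (barpi a' v).
have hT : linear (fun x : B => ceps B x *: T).
  by move=> d x y; rewrite linearP scalerDl scalerA.
rewrite /tact (tliftE (tact_bilinear_out ab a'b _)).
rewrite (linear_tlift _ _ (tact_bilinear_in ab a'b u v)).
transitivity (mklin hT (tlift (fun b1 b2 => ceps B b1 *: b2) (cdelta B b))).
  rewrite (linear_tlift _ _ (scalel_bilinear _ _)).
  congr (tlift _ _); apply/funext => x; apply/funext => y /=.
  by rewrite tmapE !barpi_act tensZl tensZr scalerA linearZ.
by rewrite cepsl tmapE.
Qed.

Section BarCoalgebra.
Variable C : modcoalg B.
Local Notation a := (mc_rmod C).
Local Notation Delta := (cdelta (mc_coalg C)).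
Local Notation eps := (ceps (mc_coalg C)).

Lemma bar_delta0 c : augmented a c -> (tmap (barpi a) (barpi a) \o Delta) c = 0.
Proof.
move=> [c' [b [b0 ->]]] /=.
by rewrite mc_delta_act barpi_diag b0 scale0r.
Qed.

Lemma bar_eps0 c : augmented a c -> (eps : {linear C -> k^o}) c = 0.
Proof. by move=> [c' [b [b0 ->]]]; rewrite mc_eps_act b0 mulr0. Qed.

Definition bar_delta : {linear bar a -> bar a ⊗ bar a} := bar_lift bar_delta0.
Definition bar_eps : {scalar bar a} := bar_lift bar_eps0.

Lemma bar_deltaE c : bar_delta (barpi a c) = tmap (barpi a) (barpi a) (Delta c).
Proof. exact: bar_liftE. Qed.

Lemma bar_epsE c : bar_eps (barpi a c) = eps c.
Proof. exact: (bar_liftE bar_eps0). Qed.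

Lemma bar_deltaA x : tassoc (tmap bar_delta idfun (bar_delta x)) =
  tmap idfun bar_delta (bar_delta x).
Proof.
have [c <-] := barpi_surj x.
rewrite (coassocl_transport bar_deltaE) cdeltaA.
by rewrite (coassocr_transport bar_deltaE bar_deltaE).
Qed.

Lemma bar_epsl x : tlift (fun c1 c2 => bar_eps c1 *: c2) (bar_delta x) = x.
Proof.
have [c <-] := barpi_surj x.
by rewrite (counitl_transport bar_deltaE bar_epsE) cepsl.
Qed.

Lemma bar_epsr x : tlift (fun c1 c2 => bar_eps c2 *: c1) (bar_delta x) = x.
Proof.
have [c <-] := barpi_surj x.
by rewrite (counitr_transport bar_deltaE bar_epsE) cepsr.
Qed.

Definition bar_coalgebra : coalgebra k :=
  Coalgebra (CoalgOn bar_deltaA bar_epsl bar_epsr).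

End BarCoalgebra.

Section BarHopf.
Variables (C : modcoalg B) (M : hopf_module C).
Local Notation am := (hm_rmod M).
Local Notation ac := (mc_rmod C).
Local Notation rho := (corho (hm_comod M)).

Lemma bar_rho0 m : augmented am m -> (tmap (barpi am) (barpi ac) \o rho) m = 0.
Proof.
move=> [m' [b [b0 ->]]] /=.
by rewrite hm_rho_act barpi_diag b0 scale0r.
Qed.

Definition bar_rho : {linear bar am -> bar am ⊗ bar_coalgebra C} :=
  bar_lift bar_rho0.

Lemma bar_rhoE m : bar_rho (barpi am m) = tmap (barpi am) (barpi ac) (rho m).
Proof. exact: bar_liftE. Qed.

Lemma bar_rhoA x : tassoc (tmap bar_rho idfun (bar_rho x)) =
  tmap idfun (cdelta (bar_coalgebra C)) (bar_rho x).
Proof.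
have [m <-] := barpi_surj x.
rewrite (coassocl_transport bar_rhoE).
rewrite (coassocr_transport bar_rhoE (@bar_deltaE C)).
exact: (congr1 (tmap _ _) (corhoA (hm_comod M) m)).
Qed.

Lemma bar_rho_eps x :
  tlift (fun m d => ceps (bar_coalgebra C) d *: m) (bar_rho x) = x.
Proof.
have [m <-] := barpi_surj x.
rewrite (counitr_transport bar_rhoE (@bar_epsE C)).
exact: (congr1 _ (corho_eps (hm_comod M) m)).
Qed.

Definition bar_comodule : comodule (bar_coalgebra C) :=
  Comodule (ComodOn bar_rhoA bar_rho_eps).

End BarHopf.

Section BarMap.
Variables (C : modcoalg B) (M N : hopf_module C) (f : hopf_hom M N).

Lemma bar_map0 m : augmented (hm_rmod M) m -> (barpi (hm_rmod N) \o f) m = 0.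
Proof.
by move=> [m' [b [b0 ->]]] /=; rewrite hopf_fun_act barpi_act b0 scale0r.
Qed.

Definition bar_map_fun : {linear bar_comodule M -> bar_comodule N} :=
  bar_lift bar_map0.

Lemma bar_map_funE m :
  bar_map_fun (barpi (hm_rmod M) m) = barpi (hm_rmod N) (f m).
Proof. exact: bar_liftE. Qed.

Lemma bar_map_funP x : corho (bar_comodule N) (bar_map_fun x) =
  tmap bar_map_fun idfun (corho (bar_comodule M) x).
Proof.
have [m <-] := barpi_surj x.
rewrite bar_map_funE; apply: etrans (bar_rhoE (f m)) _.
apply: etrans (esym (congr1 (tmap bar_map_fun idfun) (bar_rhoE m))).
rewrite hopf_fun_rho !tmap_comp.
by congr (tmap _ _ _); apply/funext => y; exact/esym/bar_map_funE.
Qed.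

Definition bar_map : comod_hom (bar_comodule M) (bar_comodule N) :=
  ComodHom bar_map_funP.

End BarMap.
End Reduction.

Section Subspace.
Variables (k : fieldType) (V : lmodType k) (D : set V) (subD : subspace D).

Definition subsp_pred of subspace D : {pred V} := [pred v | `[< D v >]].
Local Notation inD := (subsp_pred subD).

Lemma subsp_predE v : (v \in inD) <-> D v.
Proof. by rewrite unfold_in /=; split=> [/asboolP|h] //; apply/asboolP. Qed.

Lemma subsp_closed : GRing.submod_closed inD.
Proof.
have [D0 Dlin] := subD.
split=> [|a u v /subsp_predE Du /subsp_predE Dv]; apply/subsp_predE => //.
exact: Dlin.
Qed.

HB.instance Definition _ := GRing.isSubmodClosed.Build k V inD subsp_closed.

Definition subsp_type : Type := {v : V | v \in inD}.
HB.instance Definition _ := SubChoice.on subsp_type.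
HB.instance Definition _ := [SubChoice_isSubLmodule of subsp_type by <:].

Definition subsp : lmodType k := subsp_type.

Definition subsp_val (x : subsp) : V := val (x : subsp_type).

Lemma subsp_val_linear : linear subsp_val.
Proof. by []. Qed.

HB.instance Definition _ :=
  GRing.isLinear.Build k subsp V *:%R subsp_val subsp_val_linear.

Definition subsp_incl : {linear subsp -> V} := subsp_val.

Lemma subsp_incl_inj : injective subsp_incl.
Proof. exact: val_inj. Qed.

Lemma subsp_inclP x : D (subsp_incl x).
Proof. exact/subsp_predE/(valP (x : subsp_type)). Qed.

Definition subsp_in (v : V) (Dv : D v) : subsp :=
  (Sub v (proj2 (subsp_predE v) Dv) : subsp_type).

Lemma subsp_inK v Dv : subsp_incl (@subsp_in v Dv) = v.
Proof. exact: (SubK subsp_type). Qed.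

End Subspace.

(* The image of X ⊗ Y in U ⊗ V. *)
Definition tensor_sub (k : fieldType) (U V : lmodType k) (X : set U)
    (Y : set V) : set (U ⊗ V) :=
  lspan [set t | exists x y, [/\ X x, Y y & t = tens x y]].

Section Submodcoalg.
Variables (k : fieldType) (B : bialgebra k).

Definition is_submodcoalg (C : modcoalg B) (D : set C) : Prop :=
  [/\ subspace D,
      forall c, D c -> tensor_sub D D (cdelta (mc_coalg C) c) &
      forall c b, D c -> D (act (mc_rmod C) c b)].

(* The object of modcoalg B carried by a B-submodule coalgebra D of C.  Its
   comultiplication is the unique map whose composite with the injection
   D ⊗ D -> C ⊗ C is the restriction of that of C. *)
Section SubObject.
Variables (C : modcoalg B) (D : set C) (HD : is_submodcoalg D).

Definition smc_subspace : subspace D := let: And3 h _ _ := HD in h.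
Local Notation S := (subsp smc_subspace).
Local Notation i := (subsp_incl smc_subspace).

Lemma smc_delta_ex (x : S) :
  exists t : S ⊗ S, tmap i i t = cdelta (mc_coalg C) (i x).
Proof.
have [_ Dd _] := HD; have := Dd _ (subsp_inclP x).
apply: (smallest_sub (X := [set s | exists t : S ⊗ S, tmap i i t = s])).
  split=> [|a _ _ [s <-] [t <-]] /=; first by exists 0; rewrite linear0.
  by exists (a *: s + t); rewrite linearP.
move=> _ [c [d [Dc Dd' ->]]] /=.
exists (tens (subsp_in smc_subspace Dc) (subsp_in smc_subspace Dd')).
by rewrite tmapE !subsp_inK.
Qed.

Definition smc_delta_fun (x : S) : S ⊗ S := projT1 (cid (smc_delta_ex x)).

Lemma smc_delta_funE x :
  tmap i i (smc_delta_fun x) = cdelta (mc_coalg C) (i x).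
Proof. exact: (projT2 (cid (smc_delta_ex x))). Qed.

Lemma tmap_incl_inj : injective (tmap i i).
Proof. by apply: tmap_inj; exact: subsp_incl_inj. Qed.

Lemma smc_delta_linear : linear smc_delta_fun.
Proof.
move=> a x y; apply: tmap_incl_inj.
rewrite smc_delta_funE (linearP (tmap i i)) /= !smc_delta_funE.
by rewrite (linearP i) linearP.
Qed.

Definition smc_delta : {linear S -> S ⊗ S} := mklin smc_delta_linear.

Lemma smc_deltaE x : cdelta (mc_coalg C) (i x) = tmap i i (smc_delta x).
Proof. by rewrite /= smc_delta_funE. Qed.

Lemma smc_eps_linear : linear ((ceps (mc_coalg C) : C -> k^o) \o i).
Proof. by move=> a x y; rewrite /= (linearP i) linearP. Qed.

Definition smc_eps : {scalar S} := mklin smc_eps_linear.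

Lemma smc_epsE x : ceps (mc_coalg C) (i x) = smc_eps x.
Proof. by []. Qed.

Lemma smc_deltaA x : tassoc (tmap smc_delta idfun (smc_delta x)) =
  tmap idfun smc_delta (smc_delta x).
Proof.
apply: (tmap_inj (@subsp_incl_inj _ _ _ _) tmap_incl_inj).
rewrite -(coassocl_transport smc_deltaE) cdeltaA.
by rewrite (coassocr_transport smc_deltaE smc_deltaE).
Qed.

Lemma smc_epsl x : tlift (fun c1 c2 => smc_eps c1 *: c2) (smc_delta x) = x.
Proof.
apply: (@subsp_incl_inj _ _ _ smc_subspace).
by rewrite -(counitl_transport smc_deltaE smc_epsE) cepsl.
Qed.

Lemma smc_epsr x : tlift (fun c1 c2 => smc_eps c2 *: c1) (smc_delta x) = x.
Proof.
apply: (@subsp_incl_inj _ _ _ smc_subspace).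
by rewrite -(counitr_transport smc_deltaE smc_epsE) cepsr.
Qed.

Lemma smc_act_in (x : S) b : D (act (mc_rmod C) (i x) b).
Proof. by have [_ _ h] := HD; apply: h; exact: subsp_inclP. Qed.

Definition smc_act (x : S) (b : B) : S := subsp_in smc_subspace (smc_act_in x b).

Lemma smc_actE x b : i (smc_act x b) = act (mc_rmod C) (i x) b.
Proof. exact: subsp_inK. Qed.

Lemma smc_act_bilinear : bilinear smc_act.
Proof.
have [al ar] := act_bilinear (mc_rmod C).
by split=> [b|x] a y z; apply: (@subsp_incl_inj _ _ _ smc_subspace);
   rewrite (linearP i) !smc_actE ?(linearP i) ?al ?ar.
Qed.

Lemma smc_act1 x : smc_act x 1 = x.
Proof.
by apply: (@subsp_incl_inj _ _ _ smc_subspace); rewrite smc_actE act1.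
Qed.

Lemma smc_actM x b b' : smc_act x (b * b') = smc_act (smc_act x b) b'.
Proof.
by apply: (@subsp_incl_inj _ _ _ smc_subspace); rewrite !smc_actE actM.
Qed.

Definition smc_coalg : coalg_on S := CoalgOn smc_deltaA smc_epsl smc_epsr.
Definition smc_rmod : rmod_on B S := RModOn smc_act_bilinear smc_act1 smc_actM.

Lemma smc_delta_act x b : cdelta smc_coalg (act smc_rmod x b) =
  diag_act smc_rmod smc_rmod (cdelta smc_coalg x) b.
Proof.
apply: tmap_incl_inj; apply: etrans (esym (smc_deltaE _)) _.
apply: etrans (congr1 _ (smc_actE x b)) _; rewrite mc_delta_act smc_deltaE.
rewrite /diag_act /=; move: (smc_delta_fun x) => t.
have [l _] := tact_bilinear smc_act_bilinear smc_act_bilinear.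
have [l' _] :=
  tact_bilinear (act_bilinear (mc_rmod C)) (act_bilinear (mc_rmod C)).
move: t; apply: (tlift_ext (f := mklin (l' (cdelta B b)) \o tmap i i)
  (g := tmap i i \o mklin (l (cdelta B b)))) => x1 x2 /=.
have ab := act_bilinear (mc_rmod C); have sb := smc_act_bilinear.
rewrite tmapE /tact (tliftE (tact_bilinear_out ab ab _)).
rewrite (tliftE (tact_bilinear_out sb sb _)).
rewrite (linear_tlift _ _ (tact_bilinear_in sb sb x1 x2)).
congr (tlift _ _); apply/funext => b1; apply/funext => b2.
by rewrite /= tmapE !smc_actE.
Qed.

Lemma smc_eps_act x b : ceps smc_coalg (act smc_rmod x b) =
  ceps smc_coalg x * ceps B b.
Proof. by rewrite -[RHS]mc_eps_act -smc_actE. Qed.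

Definition sub_modcoalg : modcoalg B := ModCoalg smc_delta_act smc_eps_act.

End SubObject.
End Submodcoalg.

Record category := Category {
  obj :> Type;
  hom : obj -> obj -> Type;
  idm : forall x, hom x x;
  compm : forall x y z, hom y z -> hom x y -> hom x z;
  compm1 : forall x y (f : hom x y), compm f (idm x) = f;
  comp1m : forall x y (f : hom x y), compm (idm y) f = f;
  compmA : forall x y z t (h : hom z t) (g : hom y z) (f : hom x y),
    compm h (compm g f) = compm (compm h g) f
}.
Arguments hom {c} _ _.
Arguments idm {c} x.
Arguments compm {c x y z} _ _.

Record functor (X Y : category) := Functor {
  fobj :> X -> Y;
  fmap : forall x y, hom x y -> hom (fobj x) (fobj y);
  fmap1 : forall x, fmap (idm x) = idm (fobj x);
  fmapM : forall x y z (g : hom y z) (f : hom x y),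
    fmap (compm g f) = compm (fmap g) (fmap f)
}.
Arguments fmap {X Y} _ {x y} _.

Definition idfunctor (X : category) : functor X X :=
  @Functor X X id (fun _ _ f => f) (fun=> erefl) (fun _ _ _ _ _ => erefl).

Section FunctorComp.
Variables (X Y Z : category) (G : functor Y Z) (F : functor X Y).

Lemma fcomp1 x : fmap G (fmap F (idm x)) = idm (G (F x)).
Proof. by rewrite !fmap1. Qed.

Lemma fcompM x y z (g : hom y z) (f : hom x y) :
  fmap G (fmap F (compm g f)) = compm (fmap G (fmap F g)) (fmap G (fmap F f)).
Proof. by rewrite !fmapM. Qed.

Definition fcomp : functor X Z :=
  @Functor X Z (fun x => G (F x)) (fun _ _ f => fmap G (fmap F f))
    fcomp1 fcompM.
End FunctorComp.

Record nat_iso (X Y : category) (F G : functor X Y) := NatIso {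
  nt : forall x, hom (F x) (G x);
  nt_inv : forall x, hom (G x) (F x);
  nt_natural : forall x y (f : hom x y),
    compm (nt y) (fmap F f) = compm (fmap G f) (nt x);
  nt_invK : forall x, compm (nt_inv x) (nt x) = idm (F x);
  ntK : forall x, compm (nt x) (nt_inv x) = idm (G x)
}.

Definition is_equivalence (X Y : category) (F : functor X Y) : Prop :=
  exists G : functor Y X,
    inhabited (nat_iso (fcomp G F) (idfunctor X)) /\
    inhabited (nat_iso (fcomp F G) (idfunctor Y)).

Section ComoduleCategory.
Variables (k : fieldType) (D : coalgebra k).

Lemma comod_hom_ext (M N : comodule D) (f g : comod_hom M N) :
  f =1 g -> f = g.
Proof.
case: f g => [f fP] [g gP] /= /linear_ext fg; subst g.
by rewrite (Prop_irrelevance fP gP).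
Qed.

Lemma comod_id_subproof (M : comodule D) m :
  corho M (idfun m) = tmap idfun idfun (corho M m).
Proof. by rewrite tmap_id. Qed.

Definition comod_id (M : comodule D) : comod_hom M M :=
  ComodHom (comod_fun := idfun) (@comod_id_subproof M).

Lemma comod_comp_subproof (M N P : comodule D) (g : comod_hom N P)
    (f : comod_hom M N) m :
  corho P ((g \o f) m) = tmap (g \o f) idfun (corho M m).
Proof. by rewrite /= !comod_funP tmap_comp. Qed.

Definition comod_comp (M N P : comodule D) (g : comod_hom N P)
    (f : comod_hom M N) : comod_hom M P :=
  ComodHom (comod_fun := g \o f) (comod_comp_subproof g f).

Definition Comod : category.
Proof.
refine (@Category (comodule D) (@comod_hom k D) comod_id comod_comp _ _ _);
  by move=> *; apply: comod_hom_ext.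
Defined.

End ComoduleCategory.

Section HopfCategory.
Variables (k : fieldType) (B : bialgebra k) (C : modcoalg B).

Lemma hopf_hom_ext (M N : hopf_module C) (f g : hopf_hom M N) :
  f =1 g -> f = g.
Proof.
case: f g => [f fa fr] [g ga gr] /= /linear_ext fg; subst g.
by rewrite (Prop_irrelevance fa ga) (Prop_irrelevance fr gr).
Qed.

Lemma hopf_id_subproof (M : hopf_module C) m :
  corho (hm_comod M) (idfun m) = tmap idfun idfun (corho (hm_comod M) m).
Proof. by rewrite tmap_id. Qed.

Definition hopf_id (M : hopf_module C) : hopf_hom M M :=
  HopfHom (hopf_fun := idfun) (fun _ _ => erefl) (@hopf_id_subproof M).

Section HopfComp.
Variables (M N P : hopf_module C) (g : hopf_hom N P) (f : hopf_hom M N).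

Lemma hopf_comp_act m b :
  (g \o f) (act (hm_rmod M) m b) = act (hm_rmod P) ((g \o f) m) b.
Proof. by rewrite /= !hopf_fun_act. Qed.

Lemma hopf_comp_rho m : corho (hm_comod P) ((g \o f) m) =
  tmap (g \o f) idfun (corho (hm_comod M) m).
Proof. by rewrite /= !hopf_fun_rho tmap_comp. Qed.

Definition hopf_comp : hopf_hom M P :=
  HopfHom (hopf_fun := g \o f) hopf_comp_act hopf_comp_rho.
End HopfComp.

Definition Hopf : category.
Proof.
refine (@Category (hopf_module C) (@hopf_hom k B C) hopf_id hopf_comp _ _ _);
  by move=> *; apply: hopf_hom_ext.
Defined.

Lemma bar_map1 (M : hopf_module C) :
  bar_map (hopf_id M) = comod_id (bar_comodule M).
Proof.
apply: comod_hom_ext => x; have [m <-] := barpi_surj x.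
exact: bar_map_funE.
Qed.

Lemma bar_mapM (M N P : hopf_module C) (g : hopf_hom N P) (f : hopf_hom M N) :
  bar_map (hopf_comp g f) = comod_comp (bar_map g) (bar_map f).
Proof.
apply: comod_hom_ext => x; have [m <-] := barpi_surj x.
apply: etrans (bar_map_funE (hopf_comp g f) m) _.
apply: esym; apply: etrans (congr1 (bar_map_fun g) (bar_map_funE f m)) _.
exact: bar_map_funE.
Qed.

Definition bar_functor : functor Hopf (Comod (bar_coalgebra C)) :=
  @Functor Hopf (Comod (bar_coalgebra C)) (@bar_comodule k B C)
    (@bar_map k B C) bar_map1 bar_mapM.

End HopfCategory.

Section Radical.
Variables (k : fieldType) (B : bialgebra k).

(* D is an R-subcoalgebra of C. *)
Definition is_Rsub (R : modcoalg B -> Prop) (C : modcoalg B) (D : set C) :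
    Prop :=
  exists HD : is_submodcoalg D, R (sub_modcoalg HD).

Definition addsp (V : lmodType k) (X Y : set V) : set V :=
  [set z | exists x y, [/\ X x, Y y & z = x + y]].

Definition wedge (C : modcoalg B) (X Y : set C) : set C :=
  cdelta (mc_coalg C) @^-1`
    addsp (tensor_sub X setT) (tensor_sub setT Y).

Definition sumsp (V : lmodType k) (I : Type) (D : I -> set V) : set V :=
  lspan (\bigcup_i D i).

Record radical_class (R : modcoalg B -> Prop) : Prop := RadicalClass {
  radical_nonempty : exists C, R C;
  radical_sub : forall (C : modcoalg B) (D : set C) (HD : is_submodcoalg D),
    R C -> R (sub_modcoalg HD);
  radical_sum : forall (C : modcoalg B) (I : Type) (D : I -> set C),
    (forall i, is_Rsub R (D i)) -> is_Rsub R (sumsp D)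
}.

Record idempotent_radical_class (R : modcoalg B -> Prop) : Prop :=
  IdempotentRadicalClass {
  idempotent_radical :> radical_class R;
  radical_wedge : forall (C : modcoalg B) (D1 D2 : set C),
    is_Rsub R D1 -> is_Rsub R D2 -> is_Rsub R (wedge D1 D2)
}.

Definition Eclass (C : modcoalg B) : Prop := is_equivalence (bar_functor C).

End Radical.

(* Main.v *)
From HB Require Import structures.
From mathcomp Require Import all_boot all_algebra.
From mathcomp Require Import boolp classical_sets.
Require Import Defs.

Set Implicit Arguments.
Unset Strict Implicit.
Unset Printing Implicit Defensive.

Import GRing.Theory.
Local Open Scope ring_scope.
Local Open Scope classical_set_scope.

(** Membership of C in the class turns out to depend only on the B-modules
    underlying its Hopf modules: C belongs to it if and only if every M in
    M_B^C is good, i.e. Tor_1^B(M, k) = 0, and M = 0 as soon as M = M B^+.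
    If the functor is an equivalence, it preserves monomorphisms, and the
    vanishing of Tor_1 on M follows by pulling W ⊗ C -> M ⊗ C back along the
    coaction of M, for a B-linear surjection W -> M.  Conversely, if all Hopf
    modules are good the functor is exact, the unit M -> (M / M B^+) ⊗ C is
    injective, and the cotensor product of a comodule with C over C / C B^+ is
    a preimage of that comodule.

    Hopf modules over a B-submodule coalgebra D of C are those over C with
    coefficients in D, so that closure under submodule coalgebras is clear.
    Goodness is stable under extensions; since M over the wedge of X and Y has
    a submodule M^X with coefficients in X and M / M^X has coefficients in Y,
    wedges are covered.  Sums are directed unions of submodule coalgebras
    contained in iterated wedges, and goodness passes to such unions. *)

(** * Tensor products over a field *)

Section LinearAlgebra.
Variable k : fieldType.
Implicit Types U V W X : lmodType k.

Lemma lspan_min V (S D : set V) : subspace D -> S `<=` D -> lspan S `<=` D.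
Proof. by move=> HD SD; apply: smallest_sub. Qed.

Lemma sub_lspan V (S : set V) : S `<=` lspan S.
Proof. exact: sub_gen_smallest. Qed.

Lemma lspan_id V (D : set V) : subspace D -> lspan D = D.
Proof.
by move=> HD; apply/seteqP; split; [exact: lspan_min|exact: sub_lspan].
Qed.

Lemma subspace_preim V W (f : {linear V -> W}) (D : set W) :
  subspace D -> subspace (f @^-1` D).
Proof.
move=> [D0 DZ]; split=> [|a u v Du Dv] /=; first by rewrite linear0.
by rewrite linearP; exact: DZ.
Qed.

Lemma subspace_ker V W (f : {linear V -> W}) : subspace [set v | f v = 0].
Proof.
by split=> [|a u v /= fu fv] /=; rewrite ?linear0 // linearP fu fv scaler0 addr0.
Qed.

Lemma lspan_ker V W (f : {linear V -> W}) (S : set V) :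
  (forall v, S v -> f v = 0) -> forall v, lspan S v -> f v = 0.
Proof. by move=> Sf; apply: lspan_min Sf; exact: subspace_ker. Qed.

Lemma subspace_range V W (f : {linear V -> W}) : subspace (range f).
Proof.
split=> [|a _ _ [u _ <-] [v _ <-]]; first by exists 0; rewrite ?linear0.
by exists (a *: u + v) => //; rewrite linearP.
Qed.

Lemma qproj_subspace V (D : set V) v : subspace D -> qproj D v = 0 <-> D v.
Proof.
move=> HD; have := qproj_eq D v 0.
by rewrite linear0 subr0 lspan_id.
Qed.

Lemma qlift_ex V W (D : set V) (f : {linear V -> W}) :
  (forall v, D v -> f v = 0) ->
  exists g : {linear quot D -> W}, forall v, g (qproj D v) = f v.
Proof. by move=> f0; exists (mklin (qlift_linear f0)) => v; exact: qliftE. Qed.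

(** Tensoring over a field keeps [f'] injective, so vanishing after [f] can be traded for vanishing
    in V / ker f, also inside tensor products. *)
Lemma ker_factor V W (f : {linear V -> W}) :
  exists2 f' : {linear quot [set v | f v = 0] -> W},
    injective f' & forall v, f' (qproj _ v) = f v.
Proof.
have HD := subspace_ker f; set D := (X in subspace X) in HD *.
have [f' f'E] : exists g : {linear quot D -> W}, forall v, g (qproj D v) = f v.
  by apply: qlift_ex.
exists f' => // x y; have [u <-] := qproj_surj x; have [v <-] := qproj_surj y.
rewrite !f'E => fuv; apply/eqP; rewrite -subr_eq0 -linearB; apply/eqP.
by apply/(qproj_subspace _ HD); rewrite /D /= linearB fuv subrr.
Qed.

(* Over a field the kernel of f is a direct summand: e projects onto it and h
   inverts f on the complement. *)
Lemma ker_split V W (f : {linear V -> W}) :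
  exists (e : {linear V -> V}) (h : {linear W -> V}),
    [/\ forall v, f (e v) = 0, forall v, f v = 0 -> e v = v &
        forall v, h (f v) = v - e v].
Proof.
have HD := subspace_ker f; have [f' f'_inj f'E] := ker_factor f.
set D := (X in subspace X) in HD f' f'_inj f'E.
have [r rK] := linear_retract f'_inj.
have [s sK] := linear_retract (@subsp_incl_inj _ _ _ HD).
have [e eE] : exists e : {linear V -> V}, forall v, e v = subsp_incl HD (s v).
  by exists (subsp_incl HD \o s).
have eid v : f v = 0 -> e v = v.
  by move=> fv; rewrite eE -[v](@subsp_inK _ _ _ HD _ fv) sK.
have fe v : f (e v) = 0 by rewrite eE; exact: (subsp_inclP (s v)).
have [h hE] : exists g : {linear quot D -> V}, forall v,
    g (qproj D v) = (idfun \- e) v.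
  by apply: qlift_ex => v fv /=; rewrite eid ?subrr.
exists e, (h \o r); split=> // v.
by rewrite /= -f'E rK hE.
Qed.

Lemma tens0r U V (u : U) : tens u (0 : V) = 0.
Proof. exact: (linear0 (mklin (@tens_linr k U V u))). Qed.

Definition tensl U V (u : U) : {linear V -> U ⊗ V} := mklin (@tens_linr k U V u).

Lemma tmap0 U V U' V' (f : {linear U -> U'}) (g : {linear V -> V'}) :
  tmap f g 0 = 0.
Proof. exact: (linear0 (mklin (tmap_linear f g))). Qed.

Lemma tmapP U V U' V' (f : {linear U -> U'}) (g : {linear V -> V'}) a x y :
  tmap f g (a *: x + y) = a *: tmap f g x + tmap f g y.
Proof. exact: (tmap_linear f g). Qed.

Lemma tmapB U V U' V' (f : {linear U -> U'}) (g : {linear V -> V'}) x y :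
  tmap f g (x - y) = tmap f g x - tmap f g y.
Proof. exact: (linearB (mklin (tmap_linear f g))). Qed.

Lemma tens_ext U V W (F G : U ⊗ V -> W) : linear F -> linear G ->
  (forall u v, F (tens u v) = G (tens u v)) -> F =1 G.
Proof. by move=> LF LG; apply: (tlift_ext (f := mklin LF) (g := mklin LG)). Qed.

Lemma tmap_rr U V V' V2 (g' : {linear V -> V'}) (g : {linear V' -> V2})
    (t : U ⊗ V) : tmap idfun g (tmap idfun g' t) = tmap idfun (g \o g') t.
Proof. exact: (tmap_comp idfun g' idfun g). Qed.

Lemma tmap_ll U V U' U2 (f' : {linear U -> U'}) (f : {linear U' -> U2})
    (t : U ⊗ V) : tmap f idfun (tmap f' idfun t) = tmap (f \o f') idfun t.
Proof. exact: (tmap_comp f' idfun f idfun). Qed.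

Lemma tmap_lr U V U' V' (f : {linear U -> U'}) (g : {linear V -> V'})
    (t : U ⊗ V) : tmap f idfun (tmap idfun g t) = tmap f g t.
Proof. exact: (tmap_comp idfun g f idfun). Qed.

Lemma tmap_rl U V U' V' (f : {linear U -> U'}) (g : {linear V -> V'})
    (t : U ⊗ V) : tmap idfun g (tmap f idfun t) = tmap f g t.
Proof. exact: (tmap_comp f idfun idfun g). Qed.

Lemma tmap_eq U V U' V' (f f' : U -> U') (g g' : V -> V') t :
  f =1 f' -> g =1 g' -> tmap f g t = tmap f' g' t.
Proof. by move=> /funext -> /funext ->. Qed.

Lemma subr_lin V W (F G : V -> W) : linear F -> linear G ->
  linear (fun x => F x - G x).
Proof.
by move=> LF LG a x y; rewrite LF LG scalerBr opprD addrACA.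
Qed.

Lemma tensBl U V (x y : U) (v : V) : tens (x - y) v = tens x v - tens y v.
Proof. exact: (linearB (mklin (@tens_linl k _ _ v))). Qed.

Lemma tensBr U V (u : U) (x y : V) : tens u (x - y) = tens u x - tens u y.
Proof. exact: (linearB (tensl V u)). Qed.

(** With [e] and [h] from [ker_split], h f = 1 - e, so applying 1 ⊗ h to (1 ⊗ f) t = 0 gives t = (1
    ⊗ e) t. Thus the kernel of 1 ⊗ f is U ⊗ ker f. *)
Lemma tmap_ker U V W (f : {linear V -> W}) (e : {linear V -> V})
    (h : {linear W -> V}) (t : U ⊗ V) :
  (forall v, h (f v) = v - e v) -> tmap idfun f t = 0 -> tmap idfun e t = t.
Proof.
move=> hE /(congr1 (tmap idfun h)); rewrite tmap0 tmap_rr => ht.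
have : tmap idfun (h \o f) t = t - tmap idfun e t.
  move: {ht} t; apply: tens_ext => [a x y||u v]; first exact: tmapP.
    by apply: subr_lin => [|a x y]; [|exact: tmapP].
  by rewrite !tmapE /= hE tensBr.
by rewrite ht => /esym/eqP; rewrite subr_eq0 => /eqP.
Qed.

Lemma tmap_lker U V W (f : {linear U -> W}) (e : {linear U -> U})
    (h : {linear W -> U}) (t : U ⊗ V) :
  (forall v, h (f v) = v - e v) -> tmap f idfun t = 0 -> tmap e idfun t = t.
Proof.
move=> hE /(congr1 (tmap h idfun)); rewrite tmap0 tmap_ll => ht.
have : tmap (h \o f) idfun t = t - tmap e idfun t.
  move: {ht} t; apply: tens_ext => [a x y||u v]; first exact: tmapP.
    by apply: subr_lin => [|a x y]; [|exact: tmapP].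
  by rewrite !tmapE /= hE tensBl.
by rewrite ht => /esym/eqP; rewrite subr_eq0 => /eqP.
Qed.

Lemma tmap_surj U V U' V' (f : {linear U -> U'}) (g : {linear V -> V'}) :
  (forall u', exists u, f u = u') -> (forall v', exists v, g v = v') ->
  forall t', exists t, tmap f g t = t'.
Proof.
move=> fS gS; elim/tensor_ind => [|a u' v' _ [t <-]].
  by exists 0; exact: tmap0.
have [[u <-] [v <-]] := (fS u', gS v').
by exists (a *: tens u v + t); rewrite tmapP tmapE.
Qed.

Lemma tmap_r0 U V U' V' (f : {linear U -> U'}) (g : {linear V -> V'}) t :
  (forall v, g v = 0) -> tmap f g t = 0.
Proof.
move=> g0; elim/tensor_ind: t => [|a u v t IH]; first exact: tmap0.
by rewrite tmapP IH tmapE g0 tens0r scaler0 addr0.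
Qed.

(** Membership of [t] in D ⊗ U is often expressed as vanishing in (V / D) ⊗ U. For D = ker f it
    follows from the injectivity of V / ker f -> W, which survives tensoring. *)
Lemma tmap_qproj_ker U V W (f : {linear V -> W}) (t : V ⊗ U) :
  tmap f idfun t = 0 -> tmap (qproj [set v | f v = 0]) idfun t = 0.
Proof.
move=> ft0; have [f' f'_inj f'E] := ker_factor f.
apply: (tmap_inj (f := f') (g := idfun) f'_inj (fun _ _ => id)).
by rewrite tmap_ll tmap0 (tmap_eq (f' := f) (g' := idfun)).
Qed.

Lemma tmap_qproj_rker U V W (f : {linear V -> W}) (t : U ⊗ V) :
  tmap idfun f t = 0 -> tmap idfun (qproj [set v | f v = 0]) t = 0.
Proof.
move=> ft0; have [f' f'_inj f'E] := ker_factor f.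
apply: (tmap_inj (f := idfun) (g := f') (fun _ _ => id) f'_inj).
by rewrite tmap_rr tmap0 (tmap_eq (f' := idfun) (g' := f)).
Qed.

(* A linear map that kills D factors through V / D. *)
Lemma tmap_kill U V W (D : set V) (g : {linear V -> W}) (t : U ⊗ V) :
  (forall v, D v -> g v = 0) ->
  tmap idfun (qproj D) t = 0 -> tmap idfun g t = 0.
Proof.
move=> /qlift_ex[g' g'E] /(congr1 (tmap idfun g')).
by rewrite tmap_rr tmap0 (tmap_eq (f' := idfun) (g' := g)).
Qed.

Lemma subsp_lift U V (D : set V) (HD : subspace D) (g : {linear U -> V}) :
  (forall u, D (g u)) ->
  exists g' : {linear U -> subsp HD}, forall u, subsp_incl HD (g' u) = g u.
Proof.
move=> Dg; pose g0 u := subsp_in HD (Dg u).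
have g0E u : subsp_incl HD (g0 u) = g u by exact: subsp_inK.
have g0L : linear g0.
  by move=> c x y; apply: (@subsp_incl_inj _ _ _ HD); rewrite linearP !g0E linearP.
by exists (mklin g0L).
Qed.

(** [r] is the projection of [ker_split] corestricted to D. Being one linear map for all [t], it
    yields coactions on subspaces that are linear by construction. *)
Lemma tmap_retract U V (D : set V) (HD : subspace D) :
  exists r : {linear V -> subsp HD}, forall t : V ⊗ U,
    tmap (qproj D) idfun t = 0 ->
    tmap (subsp_incl HD) idfun (tmap r idfun t) = t.
Proof.
have [e [h [qe _ hq]]] := ker_split (qproj D).
have [r rE] : exists r : {linear V -> subsp HD}, forall v, subsp_incl HD (r v) = e v.
  by apply: subsp_lift => v; apply/(qproj_subspace _ HD); exact: qe.
exists r => t t0.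
rewrite tmap_ll (tmap_eq (f' := e) (g' := idfun)) //.
exact: (tmap_lker hq t0).
Qed.

Lemma tmap_rretract U V (D : set V) (HD : subspace D) :
  exists r : {linear V -> subsp HD}, forall t : U ⊗ V,
    tmap idfun (qproj D) t = 0 ->
    tmap idfun (subsp_incl HD) (tmap idfun r t) = t.
Proof.
have [e [h [qe _ hq]]] := ker_split (qproj D).
have [r rE] : exists r : {linear V -> subsp HD}, forall v, subsp_incl HD (r v) = e v.
  by apply: subsp_lift => v; apply/(qproj_subspace _ HD); exact: qe.
exists r => t t0.
rewrite tmap_rr (tmap_eq (f' := idfun) (g' := e)) //.
exact: (tmap_ker hq t0).
Qed.

Lemma tensor_sub0l U V U' V' (X : set U) (Y : set V) (f : {linear U -> U'})
    (g : {linear V -> V'}) t : (forall u, X u -> f u = 0) ->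
  tensor_sub X Y t -> tmap f g t = 0.
Proof.
move=> f0; apply: (lspan_ker (f := mklin (tmap_linear f g))).
by move=> _ [x [y [Xx Yy ->]]]; rewrite /= tmapE f0 // tens0l.
Qed.

Lemma tensor_sub0r U V U' V' (X : set U) (Y : set V) (f : {linear U -> U'})
    (g : {linear V -> V'}) t : (forall v, Y v -> g v = 0) ->
  tensor_sub X Y t -> tmap f g t = 0.
Proof.
move=> g0; apply: (lspan_ker (f := mklin (tmap_linear f g))).
by move=> _ [x [y [Xx Yy ->]]]; rewrite /= tmapE g0 // tens0r.
Qed.

Lemma tensor_sub_tmap U V U' V' (X : set U') (Y : set V') (f : {linear U -> U'})
    (g : {linear V -> V'}) t : (forall u, X (f u)) -> (forall v, Y (g v)) ->
  tensor_sub X Y (tmap f g t).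
Proof.
move=> Xf Yg; have [S0 SZ] : subspace (tensor_sub X Y) by exact: lspan_subspace.
elim/tensor_ind: t => [|a u v t IH]; first by rewrite tmap0.
rewrite tmapP tmapE; apply: SZ => //; apply: sub_lspan.
by exists (f u), (g v); split.
Qed.

(** X ⊗ V and U ⊗ Y meet in X ⊗ Y: the projections e ⊗ 1 and 1 ⊗ e' both fix [t], hence so does e ⊗
    e', whose values lie in X ⊗ Y. *)
Lemma tensor_sub_ker U V (X : set U) (Y : set V) (t : U ⊗ V) :
  subspace X -> subspace Y ->
  tmap (qproj X) idfun t = 0 -> tmap idfun (qproj Y) t = 0 -> tensor_sub X Y t.
Proof.
move=> HX HY tX tY.
have [e [h [qe _ hq]]] := ker_split (qproj X).
have [e' [h' [qe' _ hq']]] := ker_split (qproj Y).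
rewrite -(tmap_lker hq tX) -(tmap_ker hq' tY) tmap_lr.
by apply: tensor_sub_tmap => z; apply/qproj_subspace.
Qed.

Lemma addsp_tensor_sub U V (X : set U) (Y : set V) (t : U ⊗ V) :
  subspace X -> subspace Y ->
  addsp (tensor_sub X setT) (tensor_sub setT Y) t <->
  tmap (qproj X) (qproj Y) t = 0.
Proof.
move=> HX HY; split=> [[x [y [Xx Yy ->]]]|t0].
  rewrite -[x]scale1r tmapP scale1r (tensor_sub0r _ _ Yy); last exact: qproj_eq0.
  by rewrite addr0; apply: tensor_sub0l Xx; exact: qproj_eq0.
have [e [h [qe _ hq]]] := ker_split (qproj X).
have [e' [h' [qe' _ hq']]] := ker_split (qproj Y).
(* The second summand equals (h ⊗ 1)(q_X ⊗ 1) t; applying 1 ⊗ q_Y gives (h ⊗ 1)(q_X ⊗ q_Y) t = 0, so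
   it lies in U ⊗ Y. *)
exists (tmap e idfun t), (t - tmap e idfun t); split.
- by apply: tensor_sub_tmap => // z; apply/qproj_subspace.
- have -> : t - tmap e idfun t = tmap h idfun (tmap (qproj X) idfun t).
    rewrite tmap_ll; move: {t0} t.
    apply: tens_ext => [||u v]; first by apply: subr_lin => // c x y; exact: tmapP.
      by move=> c x y; exact: tmapP.
    by rewrite !tmapE /= hq tensBl.
  set t' := tmap h _ _.
  have t'0 : tmap idfun (qproj Y) t' = 0.
    by rewrite /t' tmap_rl -(tmap_lr h (qproj Y)) tmap_rl t0 tmap0.
  rewrite -(tmap_ker hq' t'0).
  by apply: tensor_sub_tmap => // z; apply/qproj_subspace.
by rewrite addrC subrK.
Qed.

(** * Reassociation and partial counits *)

Lemma tassocP U V W a (x y : (U ⊗ V) ⊗ W) :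
  tassoc (a *: x + y) = a *: tassoc x + tassoc y.
Proof. exact: tassoc_linear. Qed.

Lemma tmap_tensl U V W a (x y : U) (t : V ⊗ W) :
  tmap (tensl V (a *: x + y)) idfun t =
  a *: tmap (tensl V x) idfun t + tmap (tensl V y) idfun t.
Proof.
elim/tensor_ind: t => [|b v w t IH]; first by rewrite !tmap0 scaler0 addr0.
rewrite !tmapP IH !tmapE /= !tens_linl !scalerDr !scalerA [a * b]mulrC.
by rewrite addrACA.
Qed.

Lemma tassocr_bilinear U V W : bilinear (fun (u : U) (t : V ⊗ W) =>
  tmap (tensl V u) idfun t : (U ⊗ V) ⊗ W).
Proof. by split=> [t|u] a x y; [exact: tmap_tensl|exact: tmapP]. Qed.

Definition tassocr U V W : U ⊗ (V ⊗ W) -> (U ⊗ V) ⊗ W :=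
  tlift (fun u t => tmap (tensl V u) idfun t).

Lemma tassocr_tens U V W (u : U) (t : V ⊗ W) :
  tassocr (tens u t) = tmap (tensl V u) idfun t.
Proof. exact: (tliftE (@tassocr_bilinear U V W)). Qed.

Lemma tassocrE U V W (u : U) (v : V) (w : W) :
  tassocr (tens u (tens v w)) = tens (tens u v) w.
Proof. by rewrite tassocr_tens tmapE. Qed.

Lemma tassocr_linear U V W : linear (@tassocr U V W).
Proof. exact: (tlift_linear (@tassocr_bilinear U V W)). Qed.

HB.instance Definition _ U V W :=
  GRing.isLinear.Build k (U ⊗ (V ⊗ W)) ((U ⊗ V) ⊗ W) *:%R
    (@tassocr U V W) (@tassocr_linear U V W).

Lemma tassocrP U V W a (x y : U ⊗ (V ⊗ W)) :
  tassocr (a *: x + y) = a *: tassocr x + tassocr y.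
Proof. exact: tassocr_linear. Qed.

Lemma tassoc0 U V W : tassoc (0 : (U ⊗ V) ⊗ W) = 0.
Proof. exact: (linear0 (mklin (@tassoc_linear k U V W))). Qed.

Lemma tassocr0 U V W : tassocr (0 : U ⊗ (V ⊗ W)) = 0.
Proof. exact: (linear0 (mklin (@tassocr_linear U V W))). Qed.

Lemma tens_extr U V W X (F G : U ⊗ (V ⊗ W) -> X) : linear F -> linear G ->
  (forall u v w, F (tens u (tens v w)) = G (tens u (tens v w))) -> F =1 G.
Proof.
move=> LF LG FG; apply: tens_ext => // u; apply: tens_ext => // a x y.
  by rewrite tens_linr LF.
by rewrite tens_linr LG.
Qed.

Lemma tens_extl U V W X (F G : (U ⊗ V) ⊗ W -> X) : linear F -> linear G ->
  (forall u v w, F (tens (tens u v) w) = G (tens (tens u v) w)) -> F =1 G.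
Proof.
move=> LF LG FG; apply: tens_ext => // t w.
move: t; apply: tens_ext => // a x y; first by rewrite tens_linl LF.
by rewrite tens_linl LG.
Qed.

Lemma tassocK U V W : cancel (@tassoc k U V W) (@tassocr U V W).
Proof.
apply: tens_extl => // [a x y|u v w]; first by rewrite tassocP tassocrP.
by rewrite tassocE tassocrE.
Qed.

Lemma tassocr_nat U V W U' V' W' (f : {linear U -> U'}) (g : {linear V -> V'})
    (h : {linear W -> W'}) t :
  tassocr (tmap f (tmap g h) t) = tmap (tmap f g) h (tassocr t).
Proof.
move: t; apply: tens_extr => [a x y|a x y|u v w].
- by rewrite !tmapP tassocrP.
- by rewrite tassocrP tmapP.
- by rewrite tassocrE !tmapE /= !tmapE tassocrE.
Qed.

(** This is W ⊗ e. Its underlying [tlift] is the expression in the counit axioms, so that [cepsr]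
    and [corho_eps] apply by conversion. *)
Definition teps (V W : lmodType k) (e : {scalar V}) : {linear W ⊗ V -> W} :=
  mklin (tlift_linear (scaler_bilinear W e)).

Lemma tepsE V W (e : {scalar V}) (w : W) v : teps W e (tens w v) = e v *: w.
Proof. exact: (tliftE (scaler_bilinear W e)). Qed.

Lemma teps_nat V V' W W' (e : {scalar V}) (e' : {scalar V'})
    (f : {linear W -> W'}) (g : {linear V -> V'}) :
  (forall v, e' (g v) = e v) ->
  forall t, teps W' e' (tmap f g t) = f (teps W e t).
Proof.
move=> eg; apply: tens_ext => [a x y|a x y|w v].
- by rewrite tmapP linearP.
- by rewrite !linearP.
- by rewrite tmapE !tepsE eg linearZ.
Qed.

Lemma teps_assoc U V W (e : {scalar W}) (t : U ⊗ (V ⊗ W)) :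
  teps (U ⊗ V) e (tassocr t) = tmap idfun (teps V e) t.
Proof.
move: t; apply: tens_extr => [a x y|a x y|u v w].
- by rewrite tassocrP linearP.
- exact: tmapP.
- by rewrite tassocrE tepsE tmapE tepsE tensZr.
Qed.

End LinearAlgebra.

(** * Right modules and diagonal actions *)

Section RightModules.
Variables (k : fieldType) (B : bialgebra k).
Implicit Types U V W : lmodType k.

Lemma actP V (a : rmod_on B V) c (u v : V) b :
  act a (c *: u + v) b = c *: act a u b + act a v b.
Proof. by have [al _] := act_bilinear a; exact: al. Qed.

Definition actr V (a : rmod_on B V) (b : B) : {linear V -> V} :=
  mklin (fun c u v => actP a c u v b).

Lemma actl_subproof V (a : rmod_on B V) (v : V) : linear (act a v).
Proof. by have [_ ar] := act_bilinear a; exact: ar. Qed.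

Definition actl V (a : rmod_on B V) (v : V) : {linear B -> V} :=
  mklin (actl_subproof a v).

Lemma actlP V (a : rmod_on B V) (v : V) c x y :
  act a v (c *: x + y) = c *: act a v x + act a v y.
Proof. exact: actl_subproof. Qed.

Lemma actZl V (a : rmod_on B V) c (v : V) b : act a (c *: v) b = c *: act a v b.
Proof. exact: (linearZ_LR (actr a b)). Qed.

Lemma actZr V (a : rmod_on B V) c (v : V) b : act a v (c *: b) = c *: act a v b.
Proof. exact: (linearZ_LR (actl a v)). Qed.

Lemma act0l V (a : rmod_on B V) b : act a 0 b = 0.
Proof. exact: (linear0 (actr a b)). Qed.

Definition rlin V W (a : rmod_on B V) (a' : rmod_on B W) (f : V -> W) :=
  forall v b, f (act a v b) = act a' (f v) b.

Lemma rlin_comp U V W (aU : rmod_on B U) (aV : rmod_on B V) (aW : rmod_on B W)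
    (g : V -> W) (f : U -> V) :
  rlin aV aW g -> rlin aU aV f -> rlin aU aW (g \o f).
Proof. by move=> gl fl v b; rewrite /= fl gl. Qed.

Section Diagonal.
Variables (U V : lmodType k) (a : rmod_on B U) (a' : rmod_on B V).

Let ab := act_bilinear a.
Let a'b := act_bilinear a'.

Lemma diagP c (s t : U ⊗ V) b :
  diag_act a a' (c *: s + t) b = c *: diag_act a a' s b + diag_act a a' t b.
Proof. by have [h _] := tact_bilinear ab a'b; exact: h. Qed.

Lemma tact_tmap u v (t : B ⊗ B) :
  tact (act a) (act a') (tens u v) t = tmap (actl a u) (actl a' v) t.
Proof.
have [_ h] := tact_bilinear ab a'b.
move: t; apply: tens_ext => [c x y|c x y|x y]; first exact: h.
  exact: tmapP.
by rewrite tactE // tmapE.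
Qed.

Lemma diagE u v b :
  diag_act a a' (tens u v) b = tmap (actl a u) (actl a' v) (cdelta B b).
Proof. exact: tact_tmap. Qed.

Lemma diag_bilinear : bilinear (diag_act a a').
Proof.
have [_ h] := tact_bilinear ab a'b.
split=> [b|t] c x y; first exact: diagP.
by rewrite /diag_act linearP; exact: h.
Qed.

Lemma diag1 t : diag_act a a' t 1 = t.
Proof.
move: t; apply: tens_ext => [c x y||u v] //; first exact: diagP.
by rewrite diagE bdelta1 tmapE /= !act1.
Qed.

Lemma mul_bilinear : bilinear ( *%R : B -> B -> B).
Proof.
split=> [b|b] c x y; first by rewrite /= mulrDl scalerAl.
by rewrite /= mulrDr scalerAr.
Qed.

(** On pure tensors this is the multiplicativity of the comultiplication of B. *)
Lemma diagM t x y :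
  diag_act a a' t (x * y) = diag_act a a' (diag_act a a' t x) y.
Proof.
have [l r] := tact_bilinear ab a'b.
have [ml mr] := tact_bilinear mul_bilinear mul_bilinear.
move: t; apply: tens_ext => [c s t|c s t|u v]; rewrite ?diagP //.
rewrite !diagE bdeltaM /diag_act; move: (cdelta B x) (cdelta B y) => s t.
move: s; apply: tens_ext => [c s s'|c s s'|b1 b2].
- by rewrite (ml t) tmapP.
- by rewrite tmapP (l t).
move: t; apply: tens_ext => [c s s'|c s s'|d1 d2].
- by rewrite (mr (tens b1 b2)) tmapP.
- exact: r.
rewrite (tactE mul_bilinear mul_bilinear) !tmapE /= (tactE ab a'b).
by rewrite !actM.
Qed.

Definition diag_rmod : rmod_on B (U ⊗ V) := RModOn diag_bilinear diag1 diagM.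

Lemma act_diag t b : act diag_rmod t b = diag_act a a' t b.
Proof. by []. Qed.

End Diagonal.

Lemma diag_nat U V U' V' (aU : rmod_on B U) (aV : rmod_on B V)
    (aU' : rmod_on B U') (aV' : rmod_on B V') (f : {linear U -> U'})
    (g : {linear V -> V'}) : rlin aU aU' f -> rlin aV aV' g ->
  rlin (diag_rmod aU aV) (diag_rmod aU' aV') (tmap f g).
Proof.
move=> fl gl t b; move: t; apply: tens_ext => [c x y|c x y|u v].
- by rewrite /= diagP tmapP.
- by rewrite tmapP /= diagP.
rewrite tmapE /= !diagE tmap_comp.
by apply: tmap_eq => x /=; [exact: fl|exact: gl].
Qed.

Lemma idfun_rlin V (a : rmod_on B V) : rlin a a idfun.
Proof. by []. Qed.

(** Coassociativity of B: on pure tensors the two actions come from the two ways of expanding [b]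
    into three factors. *)
Lemma tassocr_rlin U V W (aU : rmod_on B U) (aV : rmod_on B V)
    (aW : rmod_on B W) :
  rlin (diag_rmod aU (diag_rmod aV aW)) (diag_rmod (diag_rmod aU aV) aW)
    (@tassocr k U V W).
Proof.
move=> t b; move: t; apply: tens_extr => [c x y|c x y|u v w].
- by rewrite /= diagP tassocrP.
- by rewrite tassocrP /= diagP.
rewrite tassocrE /= !diagE.
have -> : tmap (actl aU u) (actl (diag_rmod aV aW) (tens v w)) (cdelta B b) =
    tmap (actl aU u) (tmap (actl aV v) (actl aW w))
      (tmap idfun (cdelta B) (cdelta B b)).
  by rewrite tmap_comp; apply: tmap_eq => x //=; exact: diagE.
rewrite -(cdeltaA B b : _ = tmap idfun (cdelta B) _).
rewrite (tassocr_nat (actl aU u) (actl aV v) (actl aW w)).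
rewrite (tassocK (tmap (cdelta B) idfun (cdelta B b))).
rewrite (tmap_comp (cdelta B) idfun (tmap (actl aU u) (actl aV v)) (actl aW w)).
by apply: tmap_eq => x //=; exact/esym/diagE.
Qed.

(** The hypothesis makes [e] B-linear into the trivial module k, and W ⊗ k is W as a module by the
    right counit axiom of B. *)
Lemma teps_rlin V W (aV : rmod_on B V) (aW : rmod_on B W) (e : {scalar V}) :
  (forall v b, e (act aV v b) = e v * ceps B b) ->
  rlin (diag_rmod aW aV) aW (teps W e).
Proof.
move=> ea t b; move: t; apply: tens_ext => [c x y|c x y|w v].
- by rewrite act_diag diagP linearP.
- by rewrite linearP actP.
rewrite tepsE [LHS](_ : _ = teps W e (tmap (actl aW w) (actl aV v)
  (cdelta B b))); last by congr (teps W e _); exact: diagE.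
have cE : teps B (ceps B) (cdelta B b) = b := cepsr B b.
rewrite -{2}cE; move: (cdelta B b); apply: tens_ext => [c x y|c x y|x y].
- by rewrite tmapP linearP.
- by rewrite linearP actlP.
by rewrite tmapE !tepsE /= ea actZl actZr scalerA mulrC.
Qed.

Section Trivial.
Variable V : lmodType k.

Lemma triv_bilinear : bilinear (fun (v : V) (b : B) => ceps B b *: v).
Proof. exact: scaler_bilinear. Qed.

Lemma triv1 (v : V) : ceps B 1 *: v = v.
Proof. by rewrite beps1 scale1r. Qed.

Lemma trivM (v : V) (x y : B) : ceps B (x * y) *: v = ceps B y *: (ceps B x *: v).
Proof. by rewrite bepsM scalerA mulrC. Qed.

Definition triv_rmod : rmod_on B V := RModOn triv_bilinear triv1 trivM.
End Trivial.

Section Transfer.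
Variables (S V : lmodType k) (a : rmod_on B V).

Section Pull.
Variables (i : {linear S -> V}) (actS : S -> B -> S).
Hypotheses (i_inj : injective i) (iE : forall s b, i (actS s b) = act a (i s) b).

Lemma pull_bilinear : bilinear actS.
Proof.
split=> [b|s] c x y; apply: i_inj; rewrite linearP !iE.
  by rewrite linearP actP.
exact: actlP.
Qed.

Lemma pull_act1 s : actS s 1 = s.
Proof. by apply: i_inj; rewrite iE act1. Qed.

Lemma pull_actM s x y : actS s (x * y) = actS (actS s x) y.
Proof. by apply: i_inj; rewrite !iE actM. Qed.

Definition pull_rmod : rmod_on B S := RModOn pull_bilinear pull_act1 pull_actM.
End Pull.

Section Push.
Variables (f : {linear V -> S}) (actS : S -> B -> S).
Hypotheses (fS : forall s, exists v, f v = s).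
Hypotheses (fE : forall v b, f (act a v b) = actS (f v) b).

Lemma push_bilinear : bilinear actS.
Proof.
split=> [b|s] c x y.
  have [[u <-] [v <-]] := (fS x, fS y).
  by rewrite -linearP -!fE actP linearP.
have [v <-] := fS s.
by rewrite -!fE -linearP; congr (f _); exact: actlP.
Qed.

Lemma push_act1 s : actS s 1 = s.
Proof. by have [v <-] := fS s; rewrite -fE act1. Qed.

Lemma push_actM s x y : actS s (x * y) = actS (actS s x) y.
Proof. by have [v <-] := fS s; rewrite -!fE actM. Qed.

Definition push_rmod : rmod_on B S := RModOn push_bilinear push_act1 push_actM.
End Push.
End Transfer.

Definition act_stable V (a : rmod_on B V) (D : set V) :=
  forall v b, D v -> D (act a v b).

Section SubQuot.
Variables (V : lmodType k) (a : rmod_on B V) (D : set V).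
Hypotheses (HD : subspace D) (Da : act_stable a D).

Definition sub_act (s : subsp HD) (b : B) : subsp HD :=
  subsp_in HD (Da b (subsp_inclP s)).

Lemma sub_actE s b : subsp_incl HD (sub_act s b) = act a (subsp_incl HD s) b.
Proof. exact: subsp_inK. Qed.

Definition sub_rmod : rmod_on B (subsp HD) :=
  pull_rmod (@subsp_incl_inj _ _ _ HD) sub_actE.

Lemma subsp_incl_rlin : rlin sub_rmod a (subsp_incl HD).
Proof. exact: sub_actE. Qed.

Definition quot_act (x : quot D) (b : B) : quot D :=
  qlift (qproj D \o actr a b) x.

Lemma quot_actE v b : qproj D (act a v b) = quot_act (qproj D v) b.
Proof.
rewrite /quot_act qliftE // => u Du /=; apply: qproj_eq0; exact: Da.
Qed.

Definition quot_rmod : rmod_on B (quot D) :=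
  push_rmod (@qproj_surj _ _ D) quot_actE.

Lemma qproj_rlin : rlin a quot_rmod (qproj D).
Proof. exact: quot_actE. Qed.

End SubQuot.

Lemma barpi_eq0 V (a : rmod_on B V) v :
  barpi a v = 0 <-> lspan (augmented a) v.
Proof.
by have := qproj_eq (augmented a) v 0; rewrite linear0 subr0.
Qed.

Lemma barpi_rlin V W (a : rmod_on B V) (a' : rmod_on B W) (f : {linear V -> W}) :
  rlin a a' f -> forall v, barpi a v = 0 -> barpi a' (f v) = 0.
Proof.
move=> fl v /barpi_eq0; apply: (lspan_ker (f := barpi a' \o f)).
by move=> _ [u [b [b0 ->]]] /=; rewrite fl barpi_act b0 scale0r.
Qed.

Lemma barpi_triv V W (a : rmod_on B V) (f : {linear V -> W}) :
  rlin a (triv_rmod W) f -> forall v, barpi a v = 0 -> f v = 0.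
Proof.
move=> fl v /barpi_eq0; apply: lspan_ker.
by move=> _ [u [b [b0 ->]]] /=; rewrite fl /= b0 scale0r.
Qed.

Lemma barpi_rlin_triv V (a : rmod_on B V) : rlin a (triv_rmod (bar a)) (barpi a).
Proof. by move=> v b; rewrite barpi_act. Qed.

End RightModules.

(** * Good modules *)

Section Torsion.
Variables (k : fieldType) (B : bialgebra k).
Implicit Types U V W : lmodType k.

(* D B^+ for a subset D of V. *)
Definition augset V (a : rmod_on B V) (D : set V) : set V :=
  lspan [set x | exists v b, [/\ D v, ceps B b = 0 & x = act a v b]].

Lemma barpi_augset V (a : rmod_on B V) v : barpi a v = 0 <-> augset a setT v.
Proof.
apply: iff_trans (barpi_eq0 a v) _.
rewrite /augset (_ : [set _ | _] = augmented a) //.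
by apply/seteqP; split=> x [u [b []]] => [_ b0 ->|b0 ->]; exists u, b.
Qed.

Lemma augset_map V W (a : rmod_on B V) (a' : rmod_on B W) (f : {linear V -> W})
    (D : set V) (D' : set W) : rlin a a' f -> (forall v, D v -> D' (f v)) ->
  forall v, augset a D v -> augset a' D' (f v).
Proof.
move=> fl DD'; apply: (@lspan_min _ _ _ (f @^-1` augset a' D')).
  exact/subspace_preim/lspan_subspace.
move=> _ [u [b [Du b0 ->]]]; rewrite /= fl; apply: sub_lspan.
by exists (f u), b; split=> //; exact: DD'.
Qed.

Lemma augset_mono V (a : rmod_on B V) (D D' : set V) v :
  D `<=` D' -> augset a D v -> augset a D' v.
Proof.
by move=> DD'; apply: (augset_map (f := idfun) (idfun_rlin a)).
Qed.

Section Sub.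
Variables (V : lmodType k) (a : rmod_on B V) (D : set V).
Hypotheses (HD : subspace D) (Da : act_stable a D).

(** The generators of D B^+ only involve vectors of D, so they can be formed in the module D.
    Membership in D B^+ is thus vanishing in D / D B^+, in general more than vanishing in V / V
    B^+. *)
Lemma augset_sub v : augset a D v ->
  exists s, subsp_incl HD s = v /\ barpi (sub_rmod HD Da) s = 0.
Proof.
move: v; apply: lspan_min.
  split=> [|c _ _ [s [<- s0]] [t [<- t0]]].
    by exists 0; rewrite !linear0.
  by exists (c *: s + t); rewrite !linearP s0 t0 scaler0 addr0.
move=> _ [u [b [Du b0 ->]]]; exists (act (sub_rmod HD Da) (subsp_in HD Du) b).
by rewrite subsp_incl_rlin subsp_inK barpi_act b0 scale0r.
Qed.

Lemma sub_augset s : barpi (sub_rmod HD Da) s = 0 -> augset a D (subsp_incl HD s).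
Proof.
move=> /barpi_augset; apply: augset_map; first exact: subsp_incl_rlin.
by move=> t _; exact: subsp_inclP.
Qed.

End Sub.

(* Equivalent to Tor_1^B(V, k) = 0. *)
Definition tor1_free V (a : rmod_on B V) : Prop :=
  forall W (aW : rmod_on B W) (f : {linear W -> V}), rlin aW a f ->
  (forall v, exists w, f w = v) ->
  forall w, f w = 0 -> barpi aW w = 0 -> augset aW [set u | f u = 0] w.

Definition good V (a : rmod_on B V) : Prop :=
  tor1_free a /\ ((forall v, barpi a v = 0) -> forall v : V, v = 0).

Lemma good0 V (a : rmod_on B V) : (forall v : V, v = 0) -> good a.
Proof.
move=> V0; split=> [W aW f fl fS w _ /barpi_augset|_ //].
by apply: augset_mono => u _; exact: V0.
Qed.

(** The restriction of [f] to f^-1(D) -> D is surjective with the same kernel, so the condition on D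
    applies to it. Extensions and directed unions are both reduced to placing [w] in f^-1(D) B^+. *)
Lemma tor1_free_sub V (a : rmod_on B V) (D : set V) (HD : subspace D)
    (Da : act_stable a D) W (aW : rmod_on B W) (f : {linear W -> V}) w :
  tor1_free (sub_rmod HD Da) -> rlin aW a f -> (forall v, exists w, f w = v) ->
  f w = 0 -> augset aW (f @^-1` D) w -> augset aW [set u | f u = 0] w.
Proof.
move=> torD fl fS fw0 Ew.
have HE : subspace (f @^-1` D) by exact: subspace_preim.
have Ea : act_stable aW (f @^-1` D) by move=> u b Eu; rewrite /= fl; exact: (@Da (f u)).
have [g gE] : exists g : {linear subsp HE -> subsp HD},
    forall u, subsp_incl HD (g u) = (f \o subsp_incl HE) u.
  by apply: subsp_lift => u; exact: (subsp_inclP u).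
have gl : rlin (sub_rmod HE Ea) (sub_rmod HD Da) g.
  move=> u b; apply: (@subsp_incl_inj _ _ _ HD).
  by rewrite subsp_incl_rlin !gE /= subsp_incl_rlin fl.
have gS s : exists u, g u = s.
  have [u fu] := fS (subsp_incl HD s).
  have Eu : (f @^-1` D) u by rewrite /= fu; exact: subsp_inclP.
  exists (subsp_in HE Eu); apply: (@subsp_incl_inj _ _ _ HD).
  by rewrite gE /= subsp_inK.
have [s [sw s0]] := augset_sub HE Ea Ew.
have gs0 : g s = 0.
  by apply: (@subsp_incl_inj _ _ _ HD); rewrite gE /= sw fw0 linear0.
rewrite -sw; have := torD _ _ _ gl gS _ gs0 s0.
apply: augset_map; first exact: subsp_incl_rlin.
by move=> u /= gu; have := gE u; rewrite gu linear0.
Qed.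

(** For Tor, the condition on Q applied to q f puts [w] in f^-1(D) B^+, and D does the rest. If V =
    V B^+, then Q = Q B^+, so Q = 0 and D = V; hence D = D B^+ and D = 0. *)
Lemma good_ext V (a : rmod_on B V) Q (aQ : rmod_on B Q) (q : {linear V -> Q})
    (D : set V) (HD : subspace D) (Da : act_stable a D) :
  rlin a aQ q -> (forall x, exists v, q v = x) -> (forall v, q v = 0 -> D v) ->
  (forall v, D v -> q v = 0) ->
  good (sub_rmod HD Da) -> good aQ -> good a.
Proof.
move=> ql qS qD Dq [torD faithD] [torQ faithQ]; split.
  move=> W aW f fl fS w fw0 w0; apply: (tor1_free_sub torD fl fS fw0).
  have qfS x : exists u, (q \o f) u = x.
    by have [v <-] := qS x; have [u <-] := fS v; exists u.
  have qfw0 : (q \o f) w = 0 by rewrite /= fw0 linear0.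
  apply: augset_mono (torQ W aW _ (rlin_comp ql fl) qfS w qfw0 w0) => u.
  exact: qD.
move=> V0.
have qv0 v : q v = 0.
  apply: faithQ => x; have [u <-] := qS x.
  exact: (barpi_rlin ql).
move=> v; have Dv : D v by exact: qD.
have -> : v = subsp_incl HD (subsp_in HD Dv) by rewrite subsp_inK.
rewrite (faithD _ (subsp_in HD Dv)) ?linear0 // => s.
have [|t [ts t0]] := @augset_sub _ a D HD Da (subsp_incl HD s).
  apply: (@augset_mono _ a [set v | q v = 0]) => //.
  exact: (torQ V a q ql qS _ (qv0 _) (V0 _)).
by rewrite -(@subsp_incl_inj _ _ _ HD _ _ ts).
Qed.

(** The last hypothesis makes D_s / D_s B^+ -> D_r / D_r B^+ injective. It is what the second half
    of goodness needs: if V = V B^+, a vector of D_s lies in some D_r B^+, and must be brought back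
    to D_s B^+. *)
Lemma good_directed V (a : rmod_on B V) (T : Type) (D : T -> set V)
    (HD : forall t, subspace (D t)) (Da : forall t, act_stable a (D t)) :
  (forall v, exists t, D t v) ->
  (forall s t, exists r, D s `<=` D r /\ D t `<=` D r) ->
  (forall t, good (sub_rmod (HD t) (Da t))) ->
  (forall s r v, D s `<=` D r -> D s v -> augset a (D r) v -> augset a (D s) v) ->
  good a.
Proof.
move=> Dcov Ddir Dgood Drel.
(* An element of W B^+ involves finitely many vectors of W, whose images lie in a common D_t by
   directedness. *)
have dirset W (aW : rmod_on B W) (f : {linear W -> V}) w : barpi aW w = 0 ->
    exists t, augset aW (f @^-1` D t) w.
  move=> /barpi_eq0; move: w; apply: lspan_min.
    split=> [|c u v [s su] [t tv]].
      have [t _] := Dcov 0; exists t; exact: (lspan_subspace _).1.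
    have [r [sr tr]] := Ddir s t; exists r; apply: (lspan_subspace _).2.
      by apply: augset_mono su => x; exact: sr.
    by apply: augset_mono tv => x; exact: tr.
  move=> _ [u [b [b0 ->]]]; have [t tu] := Dcov (f u).
  by exists t; apply: sub_lspan; exists u, b.
split=> [W aW f fl fS w fw0 /(dirset W aW f w) [t wt]|V0 v].
  exact: (tor1_free_sub (Dgood t).1 fl fS fw0 wt).
have [s sv] := Dcov v.
have -> : v = subsp_incl (HD s) (subsp_in (HD s) sv) by rewrite subsp_inK.
rewrite ((Dgood s).2 _ (subsp_in (HD s) sv)) ?linear0 // => x.
have [t xt] := dirset V a idfun _ (V0 (subsp_incl (HD s) x)).
have [r [sr tr]] := Ddir s t.
have xs : augset a (D s) (subsp_incl (HD s) x).
  apply: (Drel _ _ _ sr); first exact: subsp_inclP.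
  exact: augset_mono xt.
have [y [yx y0]] := augset_sub (HD s) (Da s) xs.
by rewrite -(@subsp_incl_inj _ _ _ (HD s) _ _ yx).
Qed.

End Torsion.

(** * Constructions of Hopf modules *)

Section ComoduleTransfer.
Variables (k : fieldType) (D D' : coalgebra k) (g : {linear D -> D'}).
Hypotheses (delta_g : forall d, cdelta D' (g d) = tmap g g (cdelta D d)).
Hypothesis eps_g : forall d, ceps D' (g d) = ceps D d.

Section Push.
Variables (M : lmodType k) (m_on : comod_on D M) (Q : lmodType k).
Variables (f : {linear M -> Q}) (rho : {linear Q -> Q ⊗ D'}).
Hypotheses (fS : forall x, exists m, f m = x).
Hypotheses (rhoE : forall m, rho (f m) = tmap f g (corho m_on m)).

Lemma comod_push_coassoc x :
  tassoc (tmap rho idfun (rho x)) = tmap idfun (cdelta D') (rho x).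
Proof.
have [m <-] := fS x.
rewrite (coassocl_transport rhoE) (coassocr_transport rhoE delta_g).
exact: (congr1 (tmap _ _) (corhoA m_on m)).
Qed.

Lemma comod_push_counit x :
  tlift (fun m0 d => ceps D' d *: m0) (rho x) = x.
Proof.
have [m <-] := fS x.
rewrite (counitr_transport rhoE eps_g).
exact: (congr1 _ (corho_eps m_on m)).
Qed.

Definition comod_push : comod_on D' Q :=
  ComodOn comod_push_coassoc comod_push_counit.
End Push.

Section Pull.
Variables (M : lmodType k) (m_on : comod_on D' M) (S : lmodType k).
Variables (f : {linear S -> M}) (rho : {linear S -> S ⊗ D}).
Hypotheses (f_inj : injective f) (g_inj : injective g).
Hypotheses (rhoE : forall s, corho m_on (f s) = tmap f g (rho s)).

Lemma comod_pull_coassoc s :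
  tassoc (tmap rho idfun (rho s)) = tmap idfun (cdelta D) (rho s).
Proof.
apply: (tmap_inj f_inj (tmap_inj g_inj g_inj)).
rewrite -(coassocl_transport rhoE) -(coassocr_transport rhoE delta_g).
exact: corhoA.
Qed.

Lemma comod_pull_counit s : tlift (fun m0 d => ceps D d *: m0) (rho s) = s.
Proof.
by apply: f_inj; rewrite -(counitr_transport rhoE eps_g) corho_eps.
Qed.

Definition comod_pull : comod_on D S :=
  ComodOn comod_pull_coassoc comod_pull_counit.
End Pull.
End ComoduleTransfer.

Section HopfTransfer.
Variables (k : fieldType) (B : bialgebra k) (C C' : modcoalg B).
Variable g : {linear C -> C'}.
Hypotheses
  (delta_g : forall c, cdelta (mc_coalg C') (g c) = tmap g g (cdelta (mc_coalg C) c))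
  (eps_g : forall c, ceps (mc_coalg C') (g c) = ceps (mc_coalg C) c)
  (gl : rlin (mc_rmod C) (mc_rmod C') g).

Section Push.
Variables (M : hopf_module C) (Q : lmodType k) (aQ : rmod_on B Q).
Variables (f : {linear M -> Q}) (rho : {linear Q -> Q ⊗ C'}).
Hypotheses (fl : rlin (hm_rmod M) aQ f) (fS : forall x, exists m, f m = x).
Hypotheses (rhoE : forall m, rho (f m) = tmap f g (corho (hm_comod M) m)).

Lemma hopf_push_act x b :
  rho (act aQ x b) = diag_act aQ (mc_rmod C') (rho x) b.
Proof.
have [m <-] := fS x.
by rewrite -fl !rhoE hm_rho_act; exact: (diag_nat fl gl).
Qed.

(** With [g] the identity and [f] a projection this gives quotients; with [f] the identity and [g]
    an inclusion, it regards a Hopf module over a subcoalgebra as one over the whole coalgebra. *)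
Definition hopf_push : hopf_module C' :=
  HopfModule (hm_comod := @comod_push k (mc_coalgebra C) (mc_coalgebra C') g
    delta_g eps_g _ (hm_comod M) _ f rho fS rhoE) hopf_push_act.
End Push.

Section Pull.
Variables (M : hopf_module C') (S : lmodType k) (aS : rmod_on B S).
Variables (f : {linear S -> M}) (rho : {linear S -> S ⊗ C}).
Hypotheses (fl : rlin aS (hm_rmod M) f).
Hypotheses (f_inj : injective f) (g_inj : injective g).
Hypotheses (rhoE : forall s, corho (hm_comod M) (f s) = tmap f g (rho s)).

Lemma hopf_pull_act s b :
  rho (act aS s b) = diag_act aS (mc_rmod C) (rho s) b.
Proof.
apply: (tmap_inj f_inj g_inj); rewrite -rhoE fl hm_rho_act rhoE.
exact/esym/(diag_nat fl gl).
Qed.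

(** Dually, with [g] the identity this gives sub-Hopf modules; with [f] the identity, it restricts
    the coalgebra to a subcoalgebra containing the coefficients. *)
Definition hopf_pull : hopf_module C :=
  HopfModule (hm_comod := @comod_pull k (mc_coalgebra C) (mc_coalgebra C') g
    delta_g eps_g _ (hm_comod M) _ f rho f_inj g_inj rhoE) hopf_pull_act.
End Pull.
End HopfTransfer.

Section HopfConstructions.
Variables (k : fieldType) (B : bialgebra k) (C : modcoalg B).

Local Notation Delta := (cdelta (mc_coalg C)).
Local Notation eps := (ceps (mc_coalg C)).
Local Notation aC := (mc_rmod C).

Lemma idfun_delta (c : C) : Delta (idfun c) = tmap idfun idfun (Delta c).
Proof. by rewrite tmap_id. Qed.

Lemma delta_rlin : rlin aC (diag_rmod aC aC) Delta.
Proof. exact: mc_delta_act. Qed.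

Lemma rho_rlin (M : hopf_module C) :
  rlin (hm_rmod M) (diag_rmod (hm_rmod M) aC) (corho (hm_comod M)).
Proof. exact: hm_rho_act. Qed.

(** The last condition says that the coaction maps D into D ⊗ C; stated as vanishing in (M / D) ⊗ C,
    it directly gives the coaction on M / D. *)
Definition subhopf (M : hopf_module C) (D : set M) : Prop :=
  [/\ subspace D, act_stable (hm_rmod M) D &
      forall m, D m -> tmap (qproj D) idfun (corho (hm_comod M) m) = 0].

Section SubQuotHopf.
Variables (M : hopf_module C) (D : set M) (sD : subhopf D).

Local Notation rho := (corho (hm_comod M)).

Definition subhopf_subspace : subspace D := let: And3 h _ _ := sD in h.
Definition subhopf_act : act_stable (hm_rmod M) D := let: And3 _ h _ := sD in h.

Local Notation S := (subsp subhopf_subspace).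
Local Notation i := (subsp_incl subhopf_subspace).

Lemma subhopf_rho_ex : exists r : {linear M -> S}, forall m, D m ->
  tmap i idfun (tmap r idfun (rho m)) = rho m.
Proof.
have [r rE] := tmap_retract C subhopf_subspace.
by exists r => m Dm; have [_ _ Dr] := sD; apply: rE; exact: Dr.
Qed.

Definition sub_rho : {linear S -> S ⊗ C} :=
  tmap (projT1 (cid subhopf_rho_ex)) idfun \o (rho \o i).

Lemma sub_rhoE s : rho (i s) = tmap i idfun (sub_rho s).
Proof.
by rewrite /= (projT2 (cid subhopf_rho_ex)) //; exact: subsp_inclP.
Qed.

Definition sub_hopf : hopf_module C :=
  hopf_pull idfun_delta (fun _ => erefl) (idfun_rlin aC)
    (subsp_incl_rlin (HD := subhopf_subspace) subhopf_act)
    (@subsp_incl_inj _ _ _ subhopf_subspace) (fun _ _ => id) sub_rhoE.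

Definition sub_hopf_incl : hopf_hom sub_hopf M :=
  HopfHom (M := sub_hopf) (hopf_fun := i)
    (subsp_incl_rlin (HD := subhopf_subspace) subhopf_act) sub_rhoE.

Lemma quot_rho0 m : D m -> (tmap (qproj D) idfun \o rho) m = 0.
Proof. by have [_ _ h] := sD; exact: h. Qed.

Definition quot_rho : {linear quot D -> quot D ⊗ C} :=
  mklin (qlift_linear quot_rho0).

Lemma quot_rhoE m : quot_rho (qproj D m) = tmap (qproj D) idfun (rho m).
Proof. exact: (qliftE quot_rho0). Qed.

Definition quot_hopf : hopf_module C :=
  hopf_push idfun_delta (fun _ => erefl) (idfun_rlin aC)
    (qproj_rlin subhopf_act) (@qproj_surj _ _ D) quot_rhoE.

Definition quot_hopf_proj : hopf_hom M quot_hopf :=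
  HopfHom (N := quot_hopf) (hopf_fun := qproj D)
    (qproj_rlin subhopf_act) quot_rhoE.

End SubQuotHopf.

Section KernelRange.
Variables (M N : hopf_module C) (h : hopf_hom M N).

Lemma subhopf_ker : subhopf [set m | h m = 0].
Proof.
have HD := subspace_ker h; split=> // [m b /= hm|m hm].
  by rewrite hopf_fun_act hm act0l.
by apply: tmap_qproj_ker; rewrite -hopf_fun_rho hm linear0.
Qed.

Lemma subhopf_range : subhopf (range h).
Proof.
have HD := subspace_range h; split=> // [_ b [m _ <-]|_ [m _ <-]].
  by exists (act (hm_rmod M) m b) => //; rewrite hopf_fun_act.
rewrite hopf_fun_rho tmap_ll.
elim/tensor_ind: (corho _ _) => [|c u v t IH]; first exact: tmap0.
by rewrite tmapP IH tmapE /= qproj_eq0 ?tens0l ?scaler0 ?addr0 //; exists u.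
Qed.
End KernelRange.

Section Diagonal.
Variables (W : lmodType k) (aW : rmod_on B W).

Definition wrho : {linear W ⊗ C -> (W ⊗ C) ⊗ C} :=
  @tassocr k W C C \o tmap idfun Delta.

Lemma wrho_tens w c : wrho (tens w c) = tmap (tensl C w) idfun (Delta c).
Proof. by rewrite /= tmapE tassocr_tens. Qed.

Lemma wrhoP c (s t : W ⊗ C) : wrho (c *: s + t) = c *: wrho s + wrho t.
Proof. exact: linearP. Qed.

Lemma wrhoA t :
  tassoc (tmap wrho idfun (wrho t)) = tmap idfun Delta (wrho t).
Proof.
move: t; apply: tens_ext => [c x y|c x y|w c].
- by rewrite wrhoP tmapP tassocP.
- by rewrite wrhoP tmapP.
rewrite wrho_tens tmap_ll tmap_rl.
rewrite (tmap_eq (f' := tmap (tensl C w) idfun \o Delta) (g' := idfun)) //;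
  last by move=> d; exact: wrho_tens.
rewrite -(tmap_ll Delta (tmap (tensl C w) idfun)).
rewrite (tassoc_nat (tensl C w) idfun idfun) cdeltaA.
rewrite (tmap_comp idfun Delta (tensl C w) (tmap idfun idfun)).
by apply: tmap_eq => // d; exact: tmap_id.
Qed.

Lemma wrho_eps t : tlift (fun m0 d => eps d *: m0) (wrho t) = t.
Proof.
change (teps (W ⊗ C) eps (tassocr (tmap idfun Delta t)) = t).
rewrite teps_assoc tmap_rr -[RHS]tmap_id; apply: tmap_eq => // c.
exact: cepsr.
Qed.

Lemma wrho_act t b :
  wrho (act (diag_rmod aW aC) t b) = diag_act (diag_rmod aW aC) aC (wrho t) b.
Proof.
apply: (rlin_comp (tassocr_rlin aW aC aC)).
exact: (diag_nat (idfun_rlin aW) delta_rlin).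
Qed.

Definition wcomod : comod_on (mc_coalgebra C) (W ⊗ C) :=
  @ComodOn k (mc_coalgebra C) _ wrho wrhoA wrho_eps.

(* W ⊗ C with the diagonal action; a trivial W gives the cofree Hopf module. *)
Definition wtens : hopf_module C := 
  @HopfModule k B C _ (diag_rmod aW aC) wcomod wrho_act.

Lemma wtens_eps_rlin : rlin (diag_rmod aW aC) aW (teps W eps).
Proof. by apply: teps_rlin; exact: mc_eps_act. Qed.

(** By the left counit axiom of C. It identifies the map W ⊗ C -> W ⊗ C induced by W ⊗ ε with the
    identity. *)
Lemma teps_lcounit (t : W ⊗ C) : tmap (teps W eps) idfun (wrho t) = t.
Proof.
move: t; apply: tens_ext => [c x y||w c] //.
  by rewrite wrhoP tmapP.
rewrite wrho_tens -{2}(cepsl (mc_coalg C) c); move: (Delta c) => s.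
rewrite tmap_ll; have ceL := tlift_linear (scalel_bilinear C eps).
move: s; apply: tens_ext => [d x y|d x y|x y]; first exact: tmapP.
  by rewrite ceL tens_linr.
rewrite tmapE (tliftE (scalel_bilinear C eps)) tensZr -tensZl.
by congr tens; exact: tepsE.
Qed.

Section Sharp.
Variables (M : hopf_module C) (p : {linear M -> W}) (pl : rlin (hm_rmod M) aW p).
Local Notation rho := (corho (hm_comod M)).

(** The transpose of [p] under the adjunction between forgetting the coaction of a Hopf module and W
    |-> W ⊗ C; composing with W ⊗ ε recovers [p]. *)
Definition sharp_fun : {linear M -> W ⊗ C} := tmap p idfun \o rho.

Lemma sharp_act m b :
  sharp_fun (act (hm_rmod M) m b) = act (hm_rmod wtens) (sharp_fun m) b.
Proof.
apply: (rlin_comp (diag_nat pl (idfun_rlin aC))); exact: rho_rlin.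
Qed.

Lemma sharp_rho m :
  corho (hm_comod wtens) (sharp_fun m) = tmap sharp_fun idfun (rho m).
Proof.
change (tassocr (tmap idfun Delta (tmap p idfun (rho m))) =
  tmap sharp_fun idfun (rho m)).
rewrite tmap_rl -(tmap_ll rho (tmap p idfun)).
have e : tassocr (tmap idfun Delta (rho m)) = tmap rho idfun (rho m).
  apply: etrans (tassocK _).
  exact: (congr1 (@tassocr k M C C) (esym (corhoA (hm_comod M) m))).
rewrite -e -(tassocr_nat p idfun idfun); congr tassocr.
rewrite (tmap_comp idfun Delta p (tmap idfun idfun)).
by apply: tmap_eq => // d; exact/esym/tmap_id.
Qed.

Definition sharp : hopf_hom M wtens :=
  @HopfHom k B C M wtens sharp_fun sharp_act sharp_rho.

Lemma sharpE m : sharp m = tmap p idfun (rho m).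
Proof. by []. Qed.

Lemma teps_sharp m : teps W eps (sharp m) = p m.
Proof.
rewrite sharpE (teps_nat (e := eps) p (g := idfun)) //.
by congr (p _); exact: (corho_eps (hm_comod M)).
Qed.
End Sharp.

End Diagonal.

Section WtensMap.
Variables (W W' : lmodType k) (aW : rmod_on B W) (aW' : rmod_on B W').
Variables (f : {linear W -> W'}) (fl : rlin aW aW' f).

(** This is f ⊗ C, written as the transpose of f (W ⊗ ε) so that compatibility with action and
    coaction is inherited from [sharp]. *)
Definition wmap : hopf_hom (wtens aW) (wtens aW') :=
  sharp (M := wtens aW) (rlin_comp fl (wtens_eps_rlin aW)).

Lemma wmapE t : wmap t = tmap f idfun t.
Proof.
rewrite sharpE -{2}[t]teps_lcounit; exact/esym/(tmap_ll (teps W eps) f).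
Qed.
End WtensMap.

Lemma zero_subproof (V W : lmodType k) : linear (fun _ : V => 0 : W).
Proof. by move=> c x y; rewrite scaler0 addr0. Qed.

Definition zero_lin (V W : lmodType k) : {linear V -> W} := mklin (@zero_subproof V W).

Lemma tmap_zero (V W U : lmodType k) (t : V ⊗ U) : tmap (zero_lin V W) idfun t = 0.
Proof.
elim/tensor_ind: t => [|c u v t IH]; first exact: tmap0.
by rewrite tmapP IH tmapE tens0l scaler0 addr0.
Qed.

Lemma hopf_zero_act (M N : hopf_module C) m b :
  zero_lin M N (act (hm_rmod M) m b) = act (hm_rmod N) (zero_lin M N m) b.
Proof. by rewrite /= act0l. Qed.

Lemma hopf_zero_rho (M N : hopf_module C) m :
  corho (hm_comod N) (zero_lin M N m) =
  tmap (zero_lin M N) idfun (corho (hm_comod M) m).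
Proof. by rewrite tmap_zero linear0. Qed.

Definition hopf_zero (M N : hopf_module C) : hopf_hom M N :=
  HopfHom (@hopf_zero_act M N) (@hopf_zero_rho M N).

End HopfConstructions.

(** * Equivalences of categories *)

Lemma dep_choice (A : Type) (T : A -> Type) (P : forall x, T x -> Prop) :
  (forall x, exists y, P x y) -> exists f, forall x, P x (f x).
Proof.
by move=> h; exists (fun x => projT1 (cid (h x))) => x; exact: (projT2 (cid (h x))).
Qed.

Section Equivalences.
Variables (X Y : category) (F : functor X Y).

Definition full := forall (x y : X) (g : hom (F x) (F y)), exists f, fmap F f = g.

Definition faithful :=
  forall (x y : X) (f g : hom x y), fmap F f = fmap F g -> f = g.

Definition ess_surj := forall y : Y, exists (x : X) (u : hom (F x) y)
  (v : hom y (F x)), compm u v = idm y /\ compm v u = idm (F x).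

(** Preimages of objects are chosen; a morphism is conjugated by the chosen isomorphisms and lifted
    by fullness, and faithfulness proves every identity required of the lifts. *)
Lemma full_faithful_equivalence :
  full -> faithful -> ess_surj -> is_equivalence F.
Proof.
move=> Ffull Ffaith Feso.
have [G0 G0P] := dep_choice Feso.
have [u uP] := dep_choice G0P.
have [v vP] := dep_choice uP.
have Fex y z (f : hom y z) : exists g : hom (G0 y) (G0 z),
    fmap F g = compm (v z) (compm f (u y)) by exact: Ffull.
pose Gm y z (f : hom y z) := projT1 (cid (Fex y z f)).
have GmE y z (f : hom y z) : fmap F (Gm _ _ f) = compm (v z) (compm f (u y)).
  exact: (projT2 (cid (Fex y z f))).
have Gm1 y : Gm _ _ (idm y) = idm (G0 y).
  by apply: Ffaith; rewrite GmE fmap1 comp1m; have [] := vP y.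
have GmM y z t (g : hom z t) (f : hom y z) :
    Gm _ _ (compm g f) = compm (Gm _ _ g) (Gm _ _ f).
  apply: Ffaith; rewrite fmapM !GmE -!compmA; congr (compm (v t) _).
  congr (compm g _).
  by rewrite [compm (u z) _]compmA (vP z).1 comp1m.
pose G : functor Y X := @Functor Y X G0 Gm Gm1 GmM.
have aex x : exists f : hom (G0 (F x)) x, fmap F f = u (F x) by exact: Ffull.
have bex x : exists f : hom x (G0 (F x)), fmap F f = v (F x) by exact: Ffull.
have [a aP] := dep_choice aex.
have [b bP] := dep_choice bex.
exists G; split; constructor; last first.
  apply: (@NatIso _ _ (fcomp F G) (idfunctor Y) u v) => [y z f|y|y].
  - by rewrite /= GmE compmA (vP z).1 comp1m.
  - by have [] := vP y.
  - by have [] := vP y.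
apply: (@NatIso _ _ (fcomp G F) (idfunctor X) a b) => [x y f|x|x];
    apply: Ffaith; rewrite !fmapM ?fmap1 /= ?aP ?bP.
- by rewrite GmE compmA (vP _).1 comp1m.
- by have [] := vP (F x).
- by have [] := vP (F x).
Qed.

Hypothesis Fequiv : is_equivalence F.

Lemma equivalence_faithful : faithful.
Proof.
have [G [[i] _]] := Fequiv => x y f g fg.
have key h : h = compm (nt i y) (compm (fmap G (fmap F h)) (nt_inv i x)).
  rewrite compmA; have /= -> := nt_natural i h.
  by rewrite -compmA (ntK i) compm1.
by rewrite (key f) fg -key.
Qed.

(** The preimage is G g conjugated by the isomorphism G F -> 1. Naturality shows that its image
    under G F is G g, and G is faithful by the isomorphism F G -> 1. *)
Lemma equivalence_full : full.
Proof.
have [G [[i] [j]]] := Fequiv => x y g.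
have Gfaith (z t : Y) (a b : hom z t) : fmap G a = fmap G b -> a = b.
  have key h : h = compm (nt j t) (compm (fmap F (fmap G h)) (nt_inv j z)).
    rewrite compmA; have /= -> := nt_natural j h.
    by rewrite -compmA (ntK j) compm1.
  by move=> ab; rewrite (key a) ab -key.
exists (compm (nt i y) (compm (fmap G g) (nt_inv i x))); apply: Gfaith.
set f := compm _ _; have /= := nt_natural i f.
rewrite {2}/f -!compmA (nt_invK i) compm1 => /(congr1 (compm (nt_inv i y))).
by rewrite !compmA !(nt_invK i) !comp1m.
Qed.

(** A test object [z] is replaced by the isomorphic F (G z), out of which [a] and [b] lift to X by
    fullness. *)
Lemma equivalence_mono (x y : X) (i : hom x y) :
  (forall z (a b : hom z x), compm i a = compm i b -> a = b) ->
  forall z (a b : hom z (F x)),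
    compm (fmap F i) a = compm (fmap F i) b -> a = b.
Proof.
move=> imono z a b ab; have [G [_ [j]]] := Fequiv.
have [a' aE] := equivalence_full (compm a (nt j z)).
have [b' bE] := equivalence_full (compm b (nt j z)).
have key c : c = compm (compm c (nt j z)) (nt_inv j z) :> hom z (F x).
  by rewrite -compmA (ntK j) compm1.
rewrite (key a) (key b) -aE -bE; congr (compm (fmap F _) _).
apply: imono; apply: equivalence_faithful.
by rewrite !fmapM aE bE !compmA ab.
Qed.

End Equivalences.

(** * From the equivalence to good Hopf modules *)

Section EquivalenceGood.
Variables (k : fieldType) (B : bialgebra k).

Section Kernel.
Variables (D : coalgebra k) (M N : comodule D) (f : comod_hom M N).

Local Notation HD := (subspace_ker f).
Local Notation S := (subsp HD).
Local Notation i := (subsp_incl HD).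

Lemma comod_ker_rho_ex : exists r : {linear M -> S}, forall m, f m = 0 ->
  tmap i idfun (tmap r idfun (corho M m)) = corho M m.
Proof.
have [r rE] := tmap_retract D HD; exists r => m fm; apply: rE.
by apply: tmap_qproj_ker; rewrite -comod_funP fm linear0.
Qed.

Definition comod_ker_rho : {linear S -> S ⊗ D} :=
  tmap (projT1 (cid comod_ker_rho_ex)) idfun \o (corho M \o i).

Lemma comod_ker_rhoE s : corho M (i s) = tmap i idfun (comod_ker_rho s).
Proof.
by rewrite /= (projT2 (cid comod_ker_rho_ex)) //; exact: (subsp_inclP s).
Qed.

Lemma comod_idfun_delta d : cdelta D (idfun d) = tmap idfun idfun (cdelta D d).
Proof. by rewrite tmap_id. Qed.

Definition comod_ker : comodule D :=
  Comodule (comod_pull comod_idfun_delta (fun _ => erefl)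
    (@subsp_incl_inj _ _ _ HD) (fun _ _ => id) comod_ker_rhoE).

Definition comod_ker_incl : comod_hom comod_ker M :=
  @ComodHom k D comod_ker M i comod_ker_rhoE.

Lemma comod_zero_subproof m :
  corho M (zero_lin comod_ker M m) =
  tmap (zero_lin comod_ker M) idfun (corho comod_ker m).
Proof. by rewrite tmap_zero linear0. Qed.

Definition comod_ker_zero : comod_hom comod_ker M :=
  @ComodHom k D comod_ker M (zero_lin comod_ker M) comod_zero_subproof.

(** Over a field the kernel of [f] is a subcomodule; its inclusion and the zero map have the same
    composite with [f]. *)
Lemma comod_mono_inj :
  (forall (Z : comodule D) (a b : comod_hom Z M),
    comod_comp f a = comod_comp f b -> a = b) ->
  forall m, f m = 0 -> m = 0.
Proof.
move=> fmono m fm.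
have e : comod_ker_incl = comod_ker_zero.
  apply: fmono; apply: comod_hom_ext => x /=; rewrite linear0.
  exact: (subsp_inclP x).
by rewrite -[m](@subsp_inK _ _ _ HD _ fm) -[LHS]/(comod_ker_incl _) e.
Qed.
End Kernel.

Variables (C : modcoalg B) (CE : Eclass C).

(** The inclusion of K = ker h is a monomorphism. The equivalence preserves it, and monomorphisms of
    comodules are injective, so K / K B^+ embeds into P / P B^+. *)
Lemma Eclass_exact (P N : hopf_module C) (h : hopf_hom P N) t :
  h t = 0 -> barpi (hm_rmod P) t = 0 ->
  augset (hm_rmod P) [set u | h u = 0] t.
Proof.
move=> ht t0; pose i := sub_hopf_incl (subhopf_ker h).
have i_inj : injective i by exact: subsp_incl_inj.
have imono (Z : Hopf C) (a b : hopf_hom Z (sub_hopf (subhopf_ker h))) :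
    hopf_comp i a = hopf_comp i b -> a = b.
  move=> ab; apply: hopf_hom_ext => z; apply: i_inj.
  exact: (congr1 (fun g : hopf_hom Z P => g z) ab).
have bmono := @equivalence_mono _ _ _ CE _ _ (i : hom (_ : Hopf C) _) imono.
pose s := subsp_in (subhopf_subspace (subhopf_ker h)) ht.
have is_t : i s = t by exact: subsp_inK.
have : barpi (hm_rmod (sub_hopf (subhopf_ker h))) s = 0.
  apply: (comod_mono_inj (f := bar_map i)); first exact: bmono.
  by rewrite /= -[LHS]/(bar_map_fun i _) bar_map_funE is_t t0.
move/sub_augset; by rewrite subsp_inK.
Qed.

(** If M = M B^+, the functor identifies the identity of M with zero. *)
Lemma Eclass_faithful (M : hopf_module C) :
  (forall m, barpi (hm_rmod M) m = 0) -> forall m : M, m = 0.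
Proof.
move=> M0 m.
have e : hopf_id M = hopf_zero M M.
  apply: (equivalence_faithful CE); apply: comod_hom_ext => x.
  have [y <-] := barpi_surj x.
  by rewrite [LHS]bar_map_funE [RHS]bar_map_funE !M0.
exact: (congr1 (fun g : hopf_hom M M => g m) e).
Qed.

Section Tor.
Variables (M : hopf_module C) (W : lmodType k) (aW : rmod_on B W).
Variables (f : {linear W -> M}) (fl : rlin aW (hm_rmod M) f).
Hypothesis fS : forall m, exists w, f w = m.

Local Notation rho := (corho (hm_comod M)).
Local Notation te := (teps W (ceps (mc_coalg C))).
Let rhoM := sharp (idfun_rlin (hm_rmod M)).

Let rhoME m : rhoM m = rho m.
Proof. exact: tmap_id. Qed.

(* P is the pullback of rho : M -> M ⊗ C along f ⊗ C : W ⊗ C -> M ⊗ C. *)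
Let toN := hopf_comp (quot_hopf_proj (subhopf_range rhoM)) (wmap C fl).
Let P := sub_hopf (subhopf_ker toN).
Let incl : hopf_hom P (wtens C aW) := sub_hopf_incl (subhopf_ker toN).
Let h := hopf_comp (wmap C fl) incl.

Let te_nat t : teps M (ceps (mc_coalg C)) (tmap f idfun t) = f (te t).
Proof. exact: (@teps_nat k C C W M (ceps (mc_coalg C)) (ceps (mc_coalg C)) f idfun). Qed.

(** For a generator w = v b, surjectivity of f ⊗ C gives t0 over the coaction of f v, and t = t0 b
    works: v - (W ⊗ ε) t0 is in ker f, so the error term is in (ker f) B^+. All three conditions are
    linear in [w] and [t]. *)
Lemma Eclass_tor_lift w : barpi aW w = 0 ->
  exists t : P, [/\ barpi (hm_rmod P) t = 0, h t = rho (f w) &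
    augset aW [set u | f u = 0] (w - te (incl t))].
Proof.
move/barpi_eq0; move: w; apply: lspan_min.
  split=> [|c u v [t [t0 ht et]] [s [s0 hs es]]].
    exists 0; rewrite !linear0; split=> //; rewrite addr0.
    exact: (lspan_subspace _).1.
  exists (c *: t + s); split.
  - by rewrite (linearP (barpi _)) t0 s0 scaler0 addr0.
  - by rewrite (linearP h) ht hs (linearP f) (linearP rho).
  have -> : c *: u + v - te (incl (c *: t + s)) =
      c *: (u - te (incl t)) + (v - te (incl s)).
    by rewrite (linearP incl) (linearP te) scalerBr opprD addrACA.
  exact: (lspan_subspace _).2.
move=> _ [v [b [b0 ->]]].
have [t0 ft0] := tmap_surj fS (fun c => ex_intro (fun c' : C => idfun c' = c) c erefl)
  (rho (f v)).
have Pt0 : toN t0 = 0.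
  have -> : toN t0 = qproj (range rhoM) (tmap f idfun t0).
    by congr (qproj _ _); exact: wmapE.
  by rewrite ft0 -rhoME; apply: qproj_eq0; exists (f v).
pose t1 : P := subsp_in (subhopf_subspace (subhopf_ker toN)) Pt0.
have it1 : incl t1 = t0 by exact: subsp_inK.
exists (act (hm_rmod P) t1 b); split.
- by rewrite barpi_act b0 scale0r.
- rewrite hopf_fun_act fl rho_rlin; congr (diag_act _ _ _ b).
  by rewrite -ft0 -it1; exact: wmapE.
rewrite hopf_fun_act it1.
have -> : act aW v b - te (act (hm_rmod (wtens C aW)) t0 b) = act aW (v - te t0) b.
  rewrite [RHS](linearB (actr aW b)) /=; congr (_ - _).
  exact: (wtens_eps_rlin aW).
apply: sub_lspan; exists (v - te t0), b; split=> //=.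
rewrite linearB -te_nat ft0.
have -> : teps M (ceps (mc_coalg C)) (rho (f v)) = f v.
  exact: (corho_eps (hm_comod M)).
exact: subrr.
Qed.

(** When f w = 0 the lift [t] is in ker h, hence in (ker h) B^+ by exactness, and W ⊗ ε carries ker
    h into ker f. *)
Lemma Eclass_tor w : f w = 0 -> barpi aW w = 0 ->
  augset aW [set u | f u = 0] w.
Proof.
move=> fw0 /Eclass_tor_lift [t [t0 ht wt]].
rewrite fw0 linear0 in ht.
have tK := Eclass_exact ht t0.
have tW : augset aW [set u | f u = 0] (te (incl t)).
  apply: (augset_map (f := te \o incl) _ _ tK).
    exact: (rlin_comp (wtens_eps_rlin aW) (hopf_fun_act incl)).
  move=> u hu; rewrite /= -te_nat.
  have -> : tmap f idfun (incl u) = 0 by rewrite -[RHS]hu; exact/esym/wmapE.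
  exact: (linear0 (teps M _)).
have -> : w = 1 *: te (incl t) + (w - te (incl t)).
  by rewrite scale1r addrC subrK.
exact: (lspan_subspace _).2.
Qed.
End Tor.

Lemma Eclass_good (M : hopf_module C) : good (hm_rmod M).
Proof.
split; last exact: Eclass_faithful.
by move=> W aW f fl fS w; exact: Eclass_tor.
Qed.

End EquivalenceGood.

(** * From good Hopf modules to the equivalence *)

Lemma comod_bij_iso (k : fieldType) (D : coalgebra k) (M N : comodule D)
    (f : comod_hom M N) :
  (forall m, f m = 0 -> m = 0) -> (forall n, exists m, f m = n) ->
  exists g : comod_hom N M,
    comod_comp f g = comod_id N /\ comod_comp g f = comod_id M.
Proof.
move=> f0 fS.
have f_inj : injective f.
  move=> x y fxy; apply/eqP; rewrite -subr_eq0; apply/eqP/f0.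
  by rewrite linearB fxy subrr.
have [g gE] := dep_choice fS.
have gL : linear g by move=> c x y; apply: f_inj; rewrite linearP !gE.
have gP n : corho M (mklin gL n) = tmap (mklin gL) idfun (corho N n).
  apply: (tmap_inj f_inj (g := idfun) (fun _ _ => id)).
  rewrite -comod_funP tmap_ll -[RHS]/(tmap _ _ _).
  have -> : f (mklin gL n) = n := gE n.
  rewrite -[LHS]tmap_id; apply: tmap_eq => // x; exact/esym/gE.
exists (ComodHom gP); split; apply: comod_hom_ext => x /=; first exact: gE.
by apply: f_inj; rewrite gE.
Qed.

Section GoodEquivalence.
Variables (k : fieldType) (B : bialgebra k) (C : modcoalg B).

Local Notation aC := (mc_rmod C).
Local Notation eps := (ceps (mc_coalg C)).
Local Notation Delta := (cdelta (mc_coalg C)).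
Local Notation piC := (barpi aC).
Local Notation cofree V := (wtens C (triv_rmod B V)).
Local Notation Cbar := (bar_coalgebra C).

(** With a trivial first factor, the counit of B collapses the diagonal action to the action on C
    alone. *)
Lemma cofree_act (V : lmodType k) (t : V ⊗ C) b :
  act (hm_rmod (cofree V)) t b = tmap idfun (actr aC b) t.
Proof.
move: t; apply: tens_ext => [c x y|c x y|v c]; first exact: actP.
  exact: tmapP.
rewrite tmapE [LHS]diagE; transitivity (tens v (act aC c
  (tlift (fun b1 b2 => ceps B b1 *: b2) (cdelta B b)))); last by rewrite cepsl.
move: (cdelta B b); apply: tens_ext => [d x y|d x y|x y].
- exact: tmapP.
- have ceL := tlift_linear (scalel_bilinear B (ceps B)).
  by rewrite ceL actlP tens_linr.
rewrite tmapE (tliftE (scalel_bilinear B (ceps B))) /= actZr.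
by rewrite tensZl tensZr.
Qed.

Lemma tmap_pi_act (V : lmodType k) (t : V ⊗ C) b :
  tmap idfun piC (tmap idfun (actr aC b) t) = ceps B b *: tmap idfun piC t.
Proof.
move: t; apply: tens_ext => [c x y|c x y|v c].
- by rewrite !tmapP.
- by rewrite tmapP scalerDr !scalerA mulrC.
by rewrite !tmapE /= barpi_act tensZr.
Qed.

(** The kernel of V ⊗ C -> V ⊗ C / C B^+ is V ⊗ C B^+, and v ⊗ c b = (v ⊗ c) b. *)
Lemma cofree_barpi (V : lmodType k) (t : V ⊗ C) :
  tmap idfun piC t = 0 -> barpi (hm_rmod (cofree V)) t = 0.
Proof.
have [e [h [pe _ hp]]] := ker_split piC.
move=> /(tmap_ker hp) <-.
elim/tensor_ind: t => [|c v x t IH]; first by rewrite tmap0 linear0.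
rewrite tmapP linearP IH addr0 tmapE /=.
suff -> : barpi (hm_rmod (cofree V)) (tens v (e x)) = 0 by rewrite scaler0.
have /barpi_eq0 := pe x; move: (e x) => y.
apply: (lspan_ker (f := barpi (hm_rmod (cofree V)) \o tensl C v)).
move=> _ [c' [b [b0 ->]]] /=.
have -> : tens v (act aC c' b) = act (hm_rmod (cofree V)) (tens v c') b.
  by rewrite cofree_act tmapE.
by rewrite barpi_act b0 scale0r.
Qed.

Hypothesis Cgood : forall M : hopf_module C, good (hm_rmod M).

(** The vanishing of Tor for P / ker h, applied to the projection from P. *)
Lemma good_exact (P N : hopf_module C) (h : hopf_hom P N) t :
  h t = 0 -> barpi (hm_rmod P) t = 0 -> augset (hm_rmod P) [set u | h u = 0] t.
Proof.
move=> ht t0; pose sD := subhopf_ker h.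
have HD := subhopf_subspace sD.
have [tor _] := Cgood (quot_hopf sD).
have qt : qproj [set u | h u = 0] t = 0 by apply/qproj_subspace.
have := tor _ _ _ (qproj_rlin (subhopf_act sD)) (@qproj_surj _ _ _) t qt t0.
by apply: augset_mono => u /= /qproj_subspace -/(_ HD).
Qed.

Lemma good_sub (P N : hopf_module C) (h : hopf_hom P N)
    (s : sub_hopf (subhopf_ker h)) :
  barpi (hm_rmod P) (sub_hopf_incl (subhopf_ker h) s) = 0 ->
  barpi (hm_rmod (sub_hopf (subhopf_ker h))) s = 0.
Proof.
move=> s0; have sh := good_exact (subsp_inclP s) s0.
have [t [ts t0]] := augset_sub (subhopf_subspace (subhopf_ker h))
  (subhopf_act (subhopf_ker h)) sh.
by rewrite -(@subsp_incl_inj _ _ _ _ _ _ ts).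
Qed.

Definition bar_unit (M : hopf_module C) : hopf_hom M (cofree (bar (hm_rmod M))) :=
  sharp (barpi_rlin_triv (hm_rmod M)).

(** Composing with the counit of C gives M -> M / M B^+, so the kernel K lies in M B^+. By exactness
    K = K B^+, and K = 0 since K is good. *)
Lemma bar_unit_inj (M : hopf_module C) : injective (bar_unit M).
Proof.
have ker0 m : bar_unit M m = 0 -> m = 0.
  move=> jm; have [_ faith] := Cgood (sub_hopf (subhopf_ker (bar_unit M))).
  pose s0 := subsp_in (subhopf_subspace (subhopf_ker (bar_unit M))) jm.
  have <- : subsp_incl _ s0 = m by exact: subsp_inK.
  have -> : s0 = 0; last exact: linear0.
  apply: faith => s; apply: good_sub.
  have js : bar_unit M (sub_hopf_incl (subhopf_ker (bar_unit M)) s) = 0.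
    exact: (subsp_inclP s).
  rewrite -(teps_sharp (barpi_rlin_triv (hm_rmod M))) [sharp _ _]js.
  exact: linear0.
move=> x y jxy; apply/eqP; rewrite -subr_eq0; apply/eqP/ker0.
by rewrite linearB jxy subrr.
Qed.

Lemma bar_unit_eq0 (M N : hopf_module C) (h : hopf_hom N M) :
  (forall n, barpi (hm_rmod M) (h n) = 0) -> forall n, h n = 0.
Proof.
move=> h0 n; apply: bar_unit_inj; rewrite linear0 sharpE hopf_fun_rho tmap_ll.
rewrite -[RHS](tmap_zero _ (corho (hm_comod N) n)).
by apply: tmap_eq => // x; exact: h0.
Qed.

(** The map [g] induces H : N -> (M / M B^+) ⊗ C. The lift of [g] is j^-1 H, once H is shown to take
    values in the image of the injective unit [j]. *)
Lemma bar_functor_full : full (bar_functor C).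
Proof.
move=> N M g0; pose g : comod_hom (bar_comodule N) (bar_comodule M) := g0.
pose p : {linear N -> bar (hm_rmod M)} := g \o barpi (hm_rmod N).
have pl : rlin (hm_rmod N) (triv_rmod B (bar (hm_rmod M))) p.
  by move=> n b; rewrite /= barpi_act linearZ.
pose H := sharp pl; pose j := bar_unit M.
(* Modulo C B^+, H n and j m become the coactions of g of the class of n and of the class of m, and
   [g] is colinear. *)
have Hj n m : barpi (hm_rmod M) m = g (barpi (hm_rmod N) n) ->
    barpi (hm_rmod (cofree (bar (hm_rmod M)))) (H n - j m) = 0.
  move=> mn; apply: cofree_barpi.
  rewrite tmapB; apply/eqP; rewrite subr_eq0; apply/eqP.
  rewrite [H n]sharpE [j m]sharpE !tmap_rl.
  rewrite -[RHS](bar_rhoE m) mn.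
  apply: etrans (esym (comod_funP g _)).
  apply: etrans (esym (congr1 (tmap g idfun) (bar_rhoE n))).
  by rewrite tmap_comp.
pose q := quot_hopf_proj (subhopf_range j).
have qH n : hopf_comp q H n = 0.
  apply: bar_unit_eq0 => {}n /=.
  have [m mn] := barpi_surj (g (barpi (hm_rmod N) n)).
  have qj : q (j m) = 0 by apply: qproj_eq0; exists m.
  have -> : q (H n) = q (H n - j m) by rewrite linearB qj subr0.
  exact: (barpi_rlin (hopf_fun_act q) (Hj n m mn)).
have fex n : exists m, j m = H n.
  have /qproj_subspace := qH n.
  by move=> /(_ (subhopf_subspace (subhopf_range j))) [m _ <-]; exists m.
have j_inj : injective j by exact: bar_unit_inj.
have [f fE] := dep_choice fex.
have fL : linear f by move=> c x y; apply: j_inj; rewrite linearP !fE linearP.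
pose f' := mklin fL; have {}fE n : j (f' n) = H n := fE n.
have fa n b : f' (act (hm_rmod N) n b) = act (hm_rmod M) (f' n) b.
  by apply: j_inj; rewrite hopf_fun_act !fE hopf_fun_act.
have fr n : corho (hm_comod M) (f' n) = tmap f' idfun (corho (hm_comod N) n).
  apply: (tmap_inj (f := j) (g := idfun) j_inj (fun _ _ => id)).
  rewrite -hopf_fun_rho fE hopf_fun_rho tmap_ll.
  by apply: tmap_eq => // x; exact/esym/fE.
exists (HopfHom fa fr); apply: comod_hom_ext => x.
have [n <-] := barpi_surj x.
rewrite [LHS]bar_map_funE -[LHS](teps_sharp (barpi_rlin_triv (hm_rmod M))).
by rewrite -[RHS](teps_sharp pl); congr (teps _ _ _); exact: fE.
Qed.

Lemma bar_functor_faithful : faithful (bar_functor C).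
Proof.
move=> N M f1 f2 f12; apply: hopf_hom_ext => n.
apply: bar_unit_inj.
have pf x : barpi (hm_rmod M) (f2 x) = (barpi (hm_rmod M) \o f1) x.
  have /= := congr1 (fun h : comod_hom (bar_comodule N) (bar_comodule M) =>
    h (barpi (hm_rmod N) x)) f12.
  by rewrite [X in X = _]bar_map_funE [X in _ = X]bar_map_funE => ->.
rewrite !sharpE !hopf_fun_rho !tmap_ll.
by apply: tmap_eq => // x; rewrite /= pf.
Qed.

(** * Essential surjectivity through the cotensor product *)

Section EssSurj.
Variable V : comodule Cbar.

Local Notation X := (cofree V).
Local Notation te := (teps V eps).

(** Its transpose is the usual difference v ⊗ c |-> ρ(v) ⊗ c - v ⊗ π(c_1) ⊗ c_2, with π the
    projection onto C / C B^+. *)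
Definition cotens_fun : {linear V ⊗ C -> V ⊗ bar aC} :=
  (corho V \o te) \- tmap idfun piC.

Lemma cotensE t : cotens_fun t = corho V (te t) - tmap idfun piC t.
Proof. by []. Qed.

Lemma cotens_rlin : rlin (hm_rmod X) (triv_rmod B _) cotens_fun.
Proof.
move=> t b; rewrite !cotensE (wtens_eps_rlin (triv_rmod B V)) linearZ.
by rewrite cofree_act tmap_pi_act /= scalerBr.
Qed.

(* The kernel of cotens is the cotensor product of V and C over C / C B^+. *)
Definition cotens : hopf_hom X (cofree (V ⊗ bar aC)) := sharp cotens_rlin.

Local Notation M := (sub_hopf (subhopf_ker cotens)).
Local Notation incl := (sub_hopf_incl (subhopf_ker cotens)).

Lemma cotens_rho m : corho V (te (incl m)) = tmap idfun piC (incl m).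
Proof.
have : cotens (incl m) = 0 by exact: (subsp_inclP m).
move=> /(congr1 (teps (V ⊗ bar aC) eps)).
by rewrite linear0 teps_sharp cotensE => /eqP; rewrite subr_eq0 => /eqP.
Qed.

Definition theta : {linear M -> V} := te \o incl.

Lemma theta_rlin : rlin (hm_rmod M) (triv_rmod B V) theta.
Proof.
exact: (rlin_comp (wtens_eps_rlin (triv_rmod B V)) (hopf_fun_act incl)).
Qed.

Lemma theta0 m : augmented (hm_rmod M) m -> theta m = 0.
Proof. by move=> m0; apply: (barpi_triv theta_rlin); exact: qproj_eq0. Qed.

Definition theta_bar : {linear bar_comodule M -> V} := bar_lift theta0.

Lemma theta_barE m : theta_bar (barpi (hm_rmod M) m) = theta m.
Proof. exact: bar_liftE. Qed.

Lemma theta_bar_rho x :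
  corho V (theta_bar x) = tmap theta_bar idfun (corho (bar_comodule M) x).
Proof.
have [m <-] := barpi_surj x; rewrite theta_barE cotens_rho.
have -> : corho (bar_comodule M) (barpi (hm_rmod M) m) =
  tmap (barpi (hm_rmod M)) piC (corho (hm_comod M) m) := bar_rhoE m.
rewrite tmap_comp -[X in _ = X](tmap_eq (f := te \o incl) (g := piC)) //;
  last by move=> y; exact/esym/theta_barE.
rewrite -(tmap_comp incl idfun te piC) -hopf_fun_rho.
rewrite -{1}[incl m](teps_lcounit (incl m)).
exact: tmap_rl.
Qed.

Definition theta_hom : comod_hom (bar_comodule M) V := ComodHom theta_bar_rho.

(** On the cotensor product V ⊗ π equals the coaction of V after [theta]; so theta m = 0 puts m in
    (V ⊗ C) B^+, and exactness moves it into M B^+. *)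
Lemma theta_inj x : theta_hom x = 0 -> x = 0.
Proof.
have [m <-] := barpi_surj x; rewrite [theta_hom _]theta_barE => tm0.
apply: good_sub; apply: cofree_barpi.
by rewrite -cotens_rho -[te _]/(theta m) tm0 linear0.
Qed.

(** A lift [t] of the coaction of [v] satisfies (V ⊗ ε) t = v, but may lie outside the cotensor
    product. It is corrected by an element of (V ⊗ C) B^+, which V ⊗ ε kills as V is trivial. *)
Lemma theta_surj v : exists x, theta_hom x = v.
Proof.
have [t tv] := tmap_surj (fun u => ex_intro (fun u' : V => idfun u' = u) u erefl)
  (@barpi_surj _ _ _ aC) (corho V v).
have teE s : te s = teps V (ceps Cbar) (tmap idfun piC s).
  by rewrite (@teps_nat k C Cbar V V eps (ceps Cbar) idfun piC) // => c; exact: bar_epsE.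
have tet : te t = v by rewrite teE tv; exact: (corho_eps V).
(* By coassociativity of V this is (pb ⊗ 1)(ρ ⊗ 1) ρ(v), and pb ρ = 0 by the counit axiom. *)
have ut : tmap idfun piC (cotens t) = 0.
  rewrite sharpE tmap_rl.
  pose pb : {linear V ⊗ bar aC -> V ⊗ bar aC} :=
    (corho V \o teps V (ceps Cbar)) \- idfun.
  have -> : tmap cotens_fun piC (wrho C V t) =
      tmap pb idfun (tmap (tmap idfun piC) piC (wrho C V t)).
    rewrite tmap_comp; apply: tmap_eq => // s.
    by rewrite cotensE teE.
  have -> : tmap (tmap idfun piC) piC (wrho C V t) = tmap (corho V) idfun (corho V v).
    rewrite -(tassocr_nat idfun piC piC) -(tassocK (tmap (corho V) _ _)).
    congr tassocr; rewrite (corhoA V v) -tv !tmap_rr.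
    by apply: tmap_eq => // c; exact/esym/bar_deltaE.
  rewrite tmap_ll -[RHS](tmap_zero _ (corho V v)).
  apply: tmap_eq => // w /=.
  apply/eqP; rewrite subr_eq0; apply/eqP; congr (corho V _).
  exact: (corho_eps V).
have bu := cofree_barpi ut.
pose q := quot_hopf_proj (subhopf_range cotens).
have qu : q (cotens t) = 0 by apply: qproj_eq0; exists t.
(* Exactness at the cokernel of [cotens] puts [cotens t] in R B^+, with R the range, and each
   generator of R B^+ is the image of an element of X B^+. *)
have [t' [t'0 ut']] : exists t', barpi (hm_rmod X) t' = 0 /\ cotens t' = cotens t.
  have := good_exact qu bu; move: (cotens t).
  apply: lspan_min.
    split=> [|c _ _ [x [x0 <-]] [y [y0 <-]]]; first by exists 0; rewrite !linear0.
    by exists (c *: x + y); rewrite !linearP x0 y0 scaler0 addr0.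
  move=> _ [x [b [qx b0 ->]]].
  have [y _ <-] :=
    iffLR (qproj_subspace x (subhopf_subspace (subhopf_range cotens))) qx.
  exists (act (hm_rmod X) y b).
  split; first by rewrite barpi_act b0 scale0r.
  exact: (hopf_fun_act cotens).
have Mt : cotens (t - t') = 0 by rewrite linearB ut' subrr.
exists (barpi (hm_rmod M) (subsp_in (subhopf_subspace (subhopf_ker cotens)) Mt)).
rewrite [LHS]theta_barE /theta /= subsp_inK.
rewrite -[LHS]/(te (t - t')) linearB tet.
by rewrite (barpi_triv (wtens_eps_rlin (triv_rmod B V)) t'0) subr0.
Qed.
End EssSurj.

Lemma good_Eclass : Eclass C.
Proof.
apply: full_faithful_equivalence.
- exact: bar_functor_full.
- exact: bar_functor_faithful.
move=> V; have [g [tg gt]] := comod_bij_iso (@theta_inj V) (@theta_surj V).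
by exists (sub_hopf (subhopf_ker (cotens V))), (theta_hom V), g.
Qed.

End GoodEquivalence.

(** * Submodule coalgebras, wedges and sums *)

Section Radical.
Variables (k : fieldType) (B : bialgebra k) (C : modcoalg B).

Local Notation aC := (mc_rmod C).
Local Notation eps := (ceps (mc_coalg C)).
Local Notation Delta := (cdelta (mc_coalg C)).

Definition coeff_in (M : hopf_module C) (D : set C) : Prop :=
  forall m, tmap idfun (qproj D) (corho (hm_comod M) m) = 0.

Definition all_good (D : set C) : Prop :=
  forall M : hopf_module C, coeff_in M D -> good (hm_rmod M).

Section SubEclass.
Variables (D : set C) (HD : is_submodcoalg D).

Local Notation S := (sub_modcoalg HD).
Local Notation i := (subsp_incl (smc_subspace HD)).

(** Hopf modules over D and those over C with coefficients in D correspond with the same underlying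
    B-module, and goodness only sees that module. *)
Lemma Eclass_sub : Eclass S <-> all_good D.
Proof.
have il : rlin (mc_rmod S) aC i by exact: smc_actE.
split=> [SE M MD|Dgood].
  have [r rE] := tmap_rretract M (smc_subspace HD).
  pose rho : {linear M -> M ⊗ subsp (smc_subspace HD)} :=
    tmap idfun r \o corho (hm_comod M).
  have rhoE m : corho (hm_comod M) (idfun m) = tmap idfun i (rho m).
    by rewrite [RHS]rE.
  exact: (Eclass_good SE (@hopf_pull k B S C i (@smc_deltaE _ _ _ _ HD)
    (@smc_epsE _ _ _ _ HD) il M M (hm_rmod M) idfun rho (idfun_rlin _)
    (fun _ _ => id) (@subsp_incl_inj _ _ _ (smc_subspace HD)) rhoE)).
apply: good_Eclass => M.
pose rho : {linear M -> M ⊗ C} := tmap idfun i \o corho (hm_comod M).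
pose N := @hopf_push k B S C i (@smc_deltaE _ _ _ _ HD) (@smc_epsE _ _ _ _ HD) il
  M M (hm_rmod M) idfun rho (idfun_rlin _)
  (fun x => ex_intro (fun y : M => idfun y = x) x erefl) (fun=> erefl).
apply: (Dgood N) => m; rewrite [LHS]tmap_rr; apply: tmap_r0 => s.
by apply: qproj_eq0; exact: (subsp_inclP s).
Qed.
End SubEclass.

Lemma coeff_in_kill (M : hopf_module C) (D : set C) (Z : lmodType k)
    (g : {linear C -> Z}) : (forall c, D c -> g c = 0) -> coeff_in M D ->
  forall m, tmap idfun g (corho (hm_comod M) m) = 0.
Proof. by move=> g0 MD m; apply: tmap_kill (MD m). Qed.

Lemma corho_coassoc (M : hopf_module C) m :
  tmap (corho (hm_comod M)) idfun (corho (hm_comod M) m) =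
  tassocr (tmap idfun Delta (corho (hm_comod M) m)).
Proof.
apply: etrans (esym (tassocK _)) _.
exact: (congr1 (@tassocr k M C C) (corhoA (hm_comod M) m)).
Qed.

Lemma delta_coassoc c :
  tmap Delta idfun (Delta c) = tassocr (tmap idfun Delta (Delta c)).
Proof.
apply: etrans (esym (tassocK _)) _.
exact: (congr1 (@tassocr k C C C) (cdeltaA (mc_coalg C) c)).
Qed.

Lemma coeff_in_quot (M : hopf_module C) (D : set C) (E : set M) (sE : subhopf E) :
  coeff_in M D -> coeff_in (quot_hopf sE) D.
Proof.
move=> MD x; have [m <-] := qproj_surj x.
rewrite [corho _ _]quot_rhoE tmap_rl -(tmap_lr (qproj E) (qproj D)).
by rewrite MD tmap0.
Qed.

Lemma submodcoalg_l (X : set C) c : is_submodcoalg X -> X c ->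
  tmap (qproj X) idfun (Delta c) = 0.
Proof.
by move=> [_ Xd _] /Xd; apply: tensor_sub0l; exact: qproj_eq0.
Qed.

Lemma submodcoalg_r (X : set C) c : is_submodcoalg X -> X c ->
  tmap idfun (qproj X) (Delta c) = 0.
Proof.
by move=> [_ Xd _] /Xd; apply: tensor_sub0r; exact: qproj_eq0.
Qed.

Lemma submodcoalg_act (X : set C) : is_submodcoalg X -> act_stable aC X.
Proof. by move=> [_ _ Xa] c b; exact: Xa. Qed.

Section Part.
Variables (X : set C) (HX : is_submodcoalg X) (M : hopf_module C).

Local Notation rho := (corho (hm_comod M)).

(* The largest sub-Hopf module of M with coefficients in X. *)
Definition part_map : {linear M -> M ⊗ quot X} := tmap idfun (qproj X) \o rho.
Definition part : set M := [set m | part_map m = 0].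

(** B-stability holds because [part_map] is B-linear. For the coaction, coassociativity rewrites
    (part_map ⊗ 1) ρ through (q_X ⊗ 1) Δ, which factors through C / X, so it vanishes wherever
    [part_map] does. *)
Lemma part_subhopf : subhopf part.
Proof.
split=> [|m b pm|m pm]; first exact: subspace_ker.
  have Xa := submodcoalg_act HX.
  have h := rlin_comp (diag_nat (idfun_rlin (hm_rmod M)) (qproj_rlin Xa))
    (@rho_rlin _ _ _ M).
  by rewrite /part /= [LHS]h [X in act _ X b](pm : _ = 0) act0l.
have [kap kapE] : exists kap : {linear quot X -> quot X ⊗ C},
    forall c, kap (qproj X c) = (tmap (qproj X) idfun \o Delta) c.
  by apply: qlift_ex => c Xc; exact: submodcoalg_l.
apply: tmap_qproj_ker.
rewrite -(tmap_ll rho (tmap idfun (qproj X))) corho_coassoc.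
rewrite -(tassocr_nat idfun (qproj X) idfun) tmap_rr.
rewrite (tmap_eq (f' := idfun) (g' := kap \o qproj X)) //; last first.
  by move=> c; exact/esym/kapE.
rewrite -(tmap_rr (qproj X) kap) [X in tmap _ _ X](pm : _ = 0) tmap0.
exact: tassocr0.
Qed.

Lemma coeff_in_part : coeff_in (sub_hopf part_subhopf) X.
Proof.
move=> s; apply: (tmap_inj (f := subsp_incl (subhopf_subspace part_subhopf))
  (g := idfun) (@subsp_incl_inj _ _ _ _) (fun _ _ => id)).
rewrite tmap_lr -tmap_rl tmap0.
apply: etrans (congr1 (tmap idfun (qproj X)) (esym (sub_rhoE s))) _.
exact: (subsp_inclP s).
Qed.

End Part.
Arguments part_map X M : clear implicits.
Arguments part X M : clear implicits.

Lemma part_map_nat (X : set C) (M N : hopf_module C) (h : hopf_hom N M) n :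
  part_map X M (h n) = tmap h idfun (part_map X N n).
Proof.
rewrite [LHS](congr1 (tmap idfun (qproj X)) (hopf_fun_rho h n)) tmap_rl.
exact/esym/tmap_lr.
Qed.

Lemma wedgeP (X Y : set C) c : subspace X -> subspace Y ->
  wedge X Y c <-> tmap (qproj X) (qproj Y) (Delta c) = 0.
Proof. exact: addsp_tensor_sub. Qed.

Section Wedge.
Variables (X Y : set C) (HX : is_submodcoalg X) (HY : is_submodcoalg Y).

Local Notation pX := (qproj X).
Local Notation pY := (qproj Y).

Definition wedge_map : {linear C -> quot X ⊗ quot Y} := tmap pX pY \o Delta.

Lemma wedgeE : wedge X Y = [set c | wedge_map c = 0].
Proof.
apply/seteqP; split=> c; first by move/wedgeP; apply; exact: smc_subspace.
by move=> h; apply/wedgeP => //; exact: smc_subspace.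
Qed.

Lemma sub_wedgel : X `<=` wedge X Y.
Proof.
move=> c Xc; rewrite wedgeE /= -(tmap_rl pX pY) submodcoalg_l //.
exact: tmap0.
Qed.

Lemma sub_wedger : Y `<=` wedge X Y.
Proof.
move=> c Yc; rewrite wedgeE /= -(tmap_lr pX pY) submodcoalg_r //.
exact: tmap0.
Qed.

(** By [tensor_sub_ker] each tensor factor is treated alone. Coassociativity moves the second Δ onto
    Y or X, where it descends to the quotient as [kap]; both composites thus factor through
    [wedge_map]. *)
Lemma wedge_submodcoalg : is_submodcoalg (wedge X Y).
Proof.
rewrite wedgeE; split=> [|c wc|c b wc]; first exact: subspace_ker.
- apply: tensor_sub_ker; try exact: subspace_ker.
    apply: tmap_qproj_ker.
    have [kap kapE] : exists kap : {linear quot Y -> quot Y ⊗ C},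
        forall c, kap (pY c) = (tmap pY idfun \o Delta) c.
      by apply: qlift_ex => d Yd; exact: submodcoalg_l.
    rewrite -(tmap_ll Delta (tmap pX pY)).
    rewrite delta_coassoc.
    rewrite -(tassocr_nat pX pY idfun) (tmap_comp idfun Delta pX (tmap pY idfun)).
    rewrite (tmap_eq (f' := pX) (g' := kap \o pY)) //; last first.
      by move=> d; exact/esym/kapE.
    rewrite -(tmap_comp pX pY idfun kap) [X in tmap _ _ X](wc : _ = 0) tmap0.
    exact: tassocr0.
  apply: tmap_qproj_rker.
  have [kap kapE] : exists kap : {linear quot X -> C ⊗ quot X},
      forall c, kap (pX c) = (tmap idfun pX \o Delta) c.
    by apply: qlift_ex => d Xd; exact: submodcoalg_r.
  rewrite -(tmap_rr Delta (tmap pX pY)) -(cdeltaA (mc_coalg C) c).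
  rewrite -(tassoc_nat idfun pX pY) (tmap_comp Delta idfun (tmap idfun pX) pY).
  rewrite (tmap_eq (f' := kap \o pX) (g' := pY)) //; last first.
    by move=> d; exact/esym/kapE.
  rewrite -(tmap_comp pX pY kap idfun) [X in tmap _ _ X](wc : _ = 0) tmap0.
  exact: tassoc0.
have h := rlin_comp (diag_nat (qproj_rlin (submodcoalg_act HX))
  (qproj_rlin (submodcoalg_act HY))) (@delta_rlin _ _ C).
by rewrite /= [LHS]h [X in act _ X b](wc : _ = 0) act0l.
Qed.

Lemma all_good_wedge : all_good X -> all_good Y -> all_good (wedge X Y).
Proof.
move=> Xgood Ygood M MW; pose sD := part_subhopf HX M.
(* M / M^X embeds into M ⊗ C / X by [part_map]; after this embedding, the coefficients modulo Y are
   those of [wedge_map], which vanish. *)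
have gQ : good (hm_rmod (quot_hopf sD)).
  apply: Ygood => x; have [m <-] := qproj_surj x.
  rewrite [corho _ _]quot_rhoE tmap_rl.
  have [q' q'_inj q'E] := ker_factor (part_map X M).
  apply: (tmap_inj (f := q') (g := idfun) q'_inj (fun _ _ => id)).
  rewrite tmap0 (tmap_comp (qproj _) pY q' idfun).
  rewrite (tmap_eq (f' := part_map X M) (g' := pY)) //.
  rewrite -(tmap_comp (corho (hm_comod M)) idfun (tmap idfun pX) pY).
  rewrite corho_coassoc -(tassocr_nat idfun pX pY) tmap_rr.
  have W0 c : wedge X Y c -> wedge_map c = 0 by rewrite wedgeE.
  rewrite (coeff_in_kill (g := wedge_map) W0 MW m).
  exact: tassocr0.
have gS : good (hm_rmod (sub_hopf sD)) := Xgood _ (@coeff_in_part _ HX M).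
apply: (good_ext (aQ := quot_rmod (subhopf_act sD)) _ _ _ _ gS gQ).
- exact: qproj_rlin.
- exact: qproj_surj.
- by move=> v; move/qproj_subspace; apply; exact: (subhopf_subspace sD).
- by move=> v; exact: qproj_eq0.
Qed.

End Wedge.

(** The good submodule coalgebras D are directed, a wedge containing both its arguments, and M is
    the union of its parts M^D. *)
Lemma all_good_directed (D0 : set C) : subspace D0 ->
  (forall c, D0 c -> exists D, [/\ is_submodcoalg D, all_good D & D c]) ->
  all_good D0.
Proof.
move=> HD0 D0cov M MD0.
pose T := {D : set C | is_submodcoalg D /\ all_good D}.
have dirT (s t : T) : exists r : T, sval s `<=` sval r /\ sval t `<=` sval r.
  case: s t => [X [HX gX]] [Y [HY gY]].
  exists (exist _ (wedge X Y) (conj (wedge_submodcoalg HX HY)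
    (all_good_wedge HX HY gX gY))).
  by split; [exact: sub_wedgel|exact: sub_wedger].
pose sP (t : T) := part_subhopf (proj1 (proj2_sig t)) M.
have partS (s t : T) : sval s `<=` sval t -> part (sval s) M `<=` part (sval t) M.
  by move=> st m; apply: tmap_kill => c /st; exact: qproj_eq0.
apply: (@good_directed _ _ _ _ T (fun t => part (sval t) M)
  (fun t => subhopf_subspace (sP t)) (fun t => subhopf_act (sP t))).
- move=> m; have [e [h [qe _ hq]]] := ker_split (qproj D0).
  (* [e] projects C onto D0, so a tensor has finitely many coefficients e(c) in D0, and a single
     good D contains them all. *)
  have cov (t : M ⊗ C) : exists s : T, tmap idfun (qproj (sval s)) (tmap idfun e t) = 0.
    elim/tensor_ind: t => [|a u c t [s s0]].
      have [D [HD gD _]] := D0cov 0 HD0.1; exists (exist _ D (conj HD gD)).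
      by rewrite !tmap0.
    have [D [HD gD Dc]] := D0cov (e c) (iffLR (qproj_subspace _ HD0) (qe c)).
    have [r [Dr sr]] := dirT (exist _ D (conj HD gD)) s; exists r.
    rewrite !tmapP !tmapE /= (qproj_eq0 (Dr _ Dc)) tens0r scaler0 add0r.
    by apply: tmap_kill s0 => d /sr; exact: qproj_eq0.
  have [s s0] := cov (corho (hm_comod M) m); exists s.
  by rewrite /part /part_map /= -(tmap_ker hq (MD0 m)).
- by move=> s t; have [r [sr tr]] := dirT s t; exists r; split; exact: partS.
- move=> t; apply: (proj2 (proj2_sig t) (sub_hopf (sP t))).
  exact: coeff_in_part.
(* M^s is also the s-part of M^r. The quotient of M^r by it has coefficients in the good coalgebra
   r, so its Tor vanishes, which gives the compatibility. *)
move=> s r v sr sv rv.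
have [x [xv x0]] := augset_sub (subhopf_subspace (sP r)) (subhopf_act (sP r)) rv.
pose Sr := sub_hopf (sP r); pose i := sub_hopf_incl (sP r).
have partE (y : Sr) : part (sval s) Sr y <-> part (sval s) M (i y).
  rewrite /part /mkset part_map_nat; split=> [->|e]; first exact: tmap0.
  apply: (tmap_inj (f := i) (g := idfun) (@subsp_incl_inj _ _ _ _) (fun _ _ => id)).
  by rewrite e tmap0.
pose sQ := part_subhopf (proj1 (proj2_sig s)) Sr.
have [tor _] : good (hm_rmod (quot_hopf sQ)).
  by apply: (proj2 (proj2_sig r)); apply: coeff_in_quot; exact: coeff_in_part.
have qx : qproj (part (sval s) Sr) x = 0.
  by apply: qproj_eq0; apply/partE; rewrite [i x]xv.
have := tor _ _ _ (qproj_rlin (subhopf_act sQ)) (@qproj_surj _ _ _) x qx x0.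
rewrite -xv; apply: (augset_map (hopf_fun_act i)) => y.
by move/(qproj_subspace _ (subhopf_subspace sQ)) => /partE.
Qed.

Lemma zero_submodcoalg : is_submodcoalg [set 0 : C].
Proof.
split=> [|c /= ->|c b /= ->].
- by split=> // a u v /= -> ->; rewrite scaler0 addr0.
- by rewrite linear0; exact: (lspan_subspace _).1.
by rewrite act0l.
Qed.

(** The coaction vanishes, so M = 0 by the counit axiom. *)
Lemma all_good_zero : all_good [set 0 : C].
Proof.
move=> M MD; apply: good0 => m.
have q_inj : injective (qproj [set 0 : C]).
  move=> x y /qproj_eq; rewrite (lspan_id (smc_subspace zero_submodcoalg)).
  by move/eqP; rewrite subr_eq0 => /eqP.
have rm : corho (hm_comod M) m = 0.
  apply: (tmap_inj (f := idfun) (g := qproj [set 0 : C]) (fun _ _ => id) q_inj).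
  by rewrite tmap0; exact: MD.
rewrite -[m](corho_eps (hm_comod M)) rm.
exact: (linear0 (teps M eps)).
Qed.

Lemma sumsp_submodcoalg (I : Type) (D : I -> set C) :
  (forall i, is_submodcoalg (D i)) -> is_submodcoalg (sumsp D).
Proof.
move=> HD; have DS i : D i `<=` sumsp D.
  by move=> c Dc; apply: sub_lspan; exists i.
split=> [|c|c b]; first exact: lspan_subspace.
  apply: (@lspan_min _ _ _ (Delta @^-1` tensor_sub (sumsp D) (sumsp D))).
    exact/subspace_preim/lspan_subspace.
  move=> d [i _ Dd]; have [_ /(_ d Dd) h _] := HD i.
  move: h; apply: smallest_sub; first exact: lspan_subspace.
  move=> _ [x [y [Dx Dy ->]]]; apply: sub_lspan; exists x, y.
  by split=> //; exact: (DS i).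
apply: (@lspan_min _ _ _ (actr aC b @^-1` sumsp D)).
  exact/subspace_preim/lspan_subspace.
move=> d [i _ Dd]; apply: (DS i); exact: (submodcoalg_act (HD i)).
Qed.

(** Vectors lying in some good submodule coalgebra form a subspace, since the wedge of X and Y
    contains X + Y; hence they exhaust the sum. *)
Lemma all_good_sumsp (I : Type) (D : I -> set C) :
  (forall i, is_submodcoalg (D i) /\ all_good (D i)) -> all_good (sumsp D).
Proof.
move=> HD; apply: all_good_directed; first exact: lspan_subspace.
apply: lspan_min => [|c [i _ Dc]]; last by have [HDi gi] := HD i; exists (D i).
split=> [|a u v [X [HX gX Xu]] [Y [HY gY Yv]]].
  exists [set 0]; split=> //; first exact: zero_submodcoalg.
  exact: all_good_zero.
exists (wedge X Y); split; first exact: wedge_submodcoalg.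
  exact: all_good_wedge.
have HW := wedge_submodcoalg HX HY; apply: (smc_subspace HW).2.
  exact: sub_wedgel.
exact: sub_wedger.
Qed.

End Radical.

Definition regular_modcoalg (k : fieldType) (B : bialgebra k) : modcoalg B :=
  @ModCoalg k B B B (RModOn (mul_bilinear B) (@mulr1 B) (@mulrA B))
    (@bdeltaM k B) (@bepsM k B).

Theorem theorem4p4 (k : fieldType) (B : bialgebra k) :
  idempotent_radical_class (@Eclass k B).
Proof.
split; first split.
(* The zero coalgebra, realised inside B, is the witness. *)
- exists (sub_modcoalg (zero_submodcoalg (regular_modcoalg B))).
  by apply/Eclass_sub; exact: all_good_zero.
- move=> C D HD CE; apply/Eclass_sub => M _; exact: Eclass_good.
- move=> C I D DE.
  have HD i : is_submodcoalg (D i) by have [] := DE i.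
  exists (sumsp_submodcoalg HD); apply/Eclass_sub; apply: all_good_sumsp => i.
  by have [HDi /Eclass_sub] := DE i.
move=> C D1 D2 [H1 /Eclass_sub g1] [H2 /Eclass_sub g2].
by exists (wedge_submodcoalg H1 H2); apply/Eclass_sub; exact: all_good_wedge.
Qed.
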